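(* Let $\Gamma$ and $\Lambda$ be finitely generated sofic groups with sofic approximations $\mathcal X$ and $\mathcal Y$ respectively, and let $X_{\mathcal X}$ and $X_{\mathcal Y}$ be their associated spaces of graphs. If $X_{\mathcal X}$ and $X_{\mathcal Y}$ are coarsely equivalent, then $\Gamma$ and $\Lambda$ are quasi-isometric and uniformly measure equivalent.
   Context: **Sofic approximations.** Let $\Gamma$ be a group with finite generating set $S$. For a finite $F\subset\Gamma$ and $\varepsilon\ge 0$, a map $\sigma:\Gamma\to \mathrm{Sym}(V)$, $V$ a nonempty finite set, is an $(F,\varepsilon)$-injective almost action if there is $Y\subset V$ with $|Y|\ge(1-\varepsilon)|V|$, $\sigma(g)\sigma(h)(y)=\sigma(gh)(y)$ for all $g,h\in F$, $y\in Y$, and $\sigma(g)(y)\ne y$ for all $g\in F\setminus\{e\}$, $y\in Y$. $\Gamma$ is sofic if such almost actions exist for every finite $F$ and every $\varepsilon>0$. A sofic approximation $\mathcal X=\{X_i,\sigma_i\}_{i\in\mathbb N}$ consists of finite sets $X_i$ with $(F_i,\varepsilon_i)$-injective almost actions $\sigma_i:\Gamma\to\mathrm{Sym}(X_i)$, where $(F_i)$ is a nested sequence of finite subsets with union $\Gamma$ and $\varepsilon_i\to0$. Each $X_i$ is made an $S$-labelled graph by joining $x$ to $\sigma_i(s)(x)$ by an edge labelled $s\in S$; these graphs are always assumed connected. The space of graphs is $X_{\mathcal X}=\bigsqcup_i X_i$ with any metric $d$ restricting to the edge metric on each $X_i$ and with $d(X_i,X_j)\to\infty$ as $i+j\to\infty$,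 $i\neq j$ (any two such metrics are coarsely equivalent). Finitely generated groups carry word metrics. **Uniform measure equivalence.** $\Gamma$ and $\Lambda$ are measure equivalent if there is a (nonzero) Borel measure space $(M,\rho)$ with commuting measure-preserving, essentially free actions of $\Gamma$ (on the left) and $\Lambda$ (on the right) admitting finite-measure fundamental domains $M_\Gamma\subset M$ for the $\Gamma$-action and $M_\Lambda\subset M$ for the $\Lambda$-action. The measure equivalence is uniform if moreover for every $g\in\Gamma$ (resp. $h\in\Lambda$) there is a finite subset $S_g\subset\Lambda$ (resp. $T_h\subset\Gamma$) such that $gM_\Lambda\subset M_\Lambda S_g$ and $M_\Gamma h\subset T_hM_\Gamma$ (inclusions up to null sets). *)

(* Defs.v *)
From HB Require Import structures.
From mathcomp Require Import all_boot all_order all_fingroup all_algebra.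
From mathcomp Require Import all_classical all_reals all_analysis.

Set Implicit Arguments.
Unset Strict Implicit.
Unset Printing Implicit Defensive.

Import Order.TTheory GRing.Theory Num.Theory.
Import numFieldNormedType.Exports.

Local Open Scope classical_set_scope.
Local Open Scope ring_scope.

(* Junk value 0 when A is empty. *)
Definition least (A : set nat) : nat :=
  xget 0%N [set n | A n /\ forall m, A m -> (n <= m)%N].

(* Words in the letters S and S^-1 representing g. *)
Definition words (G : groupType) (S : seq G) (g : G) : set (seq G) :=
  [set w | all (fun x => (x \in S) || (x^-1%g \in S)) w
           /\ (\prod_(x <- w) x)%g = g].

Definition generates (G : groupType) (S : seq G) : Prop :=
  forall g, words S g !=set0.

Definition word_length (G : groupType) (S : seq G) (g : G) : nat :=
  least [set size w | w in words S g].

Definition word_metric (R : realType) (G : groupType) (S : seq G) (g h : G) : R :=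
  (word_length S (g^-1 * h)%g)%:R.

(* The products are written out pointwise because the group law of {perm V} is
   composition in the opposite order: (s * t)%g x = t (s x). *)
Definition injective_almost_action (R : realType) (G : groupType)
    (F : seq G) (eps : R) (V : finType) (sigma : G -> {perm V}) : Prop :=
  (0 < #|V|)%N /\
  exists Y : {set V},
    [/\ (1 - eps) * #|V|%:R <= #|Y|%:R,
        forall g h y, g \in F -> h \in F -> y \in Y ->
          sigma g (sigma h y) = sigma (g * h)%g y
      & forall g y, g \in F -> g != 1%g -> y \in Y -> sigma g y != y].

Definition sofic (R : realType) (G : groupType) : Prop :=
  forall (F : seq G) (eps : R), 0 < eps ->
    exists (V : finType) (sigma : G -> {perm V}),
      injective_almost_action F eps sigma.

Definition labelled_edge (G : groupType) (S : seq G) (V : finType)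
    (sigma : G -> {perm V}) : rel V :=
  fun x y => has (fun s => (sigma s x == y) || (sigma s y == x)) S.

Record sofic_approximation (R : realType) (G : groupType) (S : seq G) :=
  SoficApproximation {
    sa_set : nat -> finType;
    sa_map : forall i, G -> {perm sa_set i};
    sa_F : nat -> seq G;
    sa_eps : nat -> R;
    sa_F_nested : forall i, {subset sa_F i <= sa_F i.+1};
    sa_F_union : forall g, exists i, g \in sa_F i;
    sa_eps_ge0 : forall i, 0 <= sa_eps i;
    sa_eps_cvg : sa_eps @ \oo --> (0 : R);
    sa_almost_action : forall i,
      injective_almost_action (sa_F i) (sa_eps i) (sa_map i);
    sa_connected : forall i x y, connect (labelled_edge S (sa_map i)) x y
  }.

Definition space_of_graphs (R : realType) (G : groupType) (S : seq G)
    (X : sofic_approximation R S) : Type :=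
  {i : nat & sa_set X i}.

Definition in_component (R : realType) (G : groupType) (S : seq G)
    (X : sofic_approximation R S) (i : nat) (x : sa_set X i) :
    space_of_graphs X :=
  existT _ i x.

Definition edge_dist (V : finType) (e : rel V) (x y : V) : nat :=
  least [set size p | p in [set p | path e x p /\ last x p = y]].

Record is_metric (R : realType) (T : Type) (d : T -> T -> R) : Prop := IsMetric {
  metric_ge0 : forall x y, 0 <= d x y;
  metric_eq0 : forall x y, d x y = 0 <-> x = y;
  metric_symmetric : forall x y, d x y = d y x;
  metric_triangle : forall x y z, d x z <= d x y + d y z
}.

Record graphs_metric (R : realType) (G : groupType) (S : seq G)
    (X : sofic_approximation R S)
    (d : space_of_graphs X -> space_of_graphs X -> R) : Prop := GraphsMetric {
  graphs_is_metric : is_metric d;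
  graphs_edge : forall i (x y : sa_set X i),
    d (in_component x) (in_component y) =
    (edge_dist (labelled_edge S (sa_map X i)) x y)%:R;
  graphs_separated : forall C : R, exists N : nat, forall i j,
    i != j -> (N <= i + j)%N ->
    forall (x : sa_set X i) (y : sa_set X j),
      C <= d (in_component x) (in_component y)
}.

Definition bornologous (R : realType) (T U : Type)
    (dT : T -> T -> R) (dU : U -> U -> R) (f : T -> U) : Prop :=
  forall C : R, exists D : R, forall x y, dT x y <= C -> dU (f x) (f y) <= D.

Definition bounded_distance (R : realType) (T U : Type) (dU : U -> U -> R)
    (f g : T -> U) : Prop :=
  exists C : R, forall x, dU (f x) (g x) <= C.

(* Metric properness of f and g is a consequence of these four conditions. *)
Definition coarsely_equivalent (R : realType) (T U : Type)
    (dT : T -> T -> R) (dU : U -> U -> R) : Prop :=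
  exists (f : T -> U) (g : U -> T),
    [/\ bornologous dT dU f, bornologous dU dT g,
        bounded_distance dT (g \o f) id & bounded_distance dU (f \o g) id].

Definition quasi_isometric (R : realType) (T U : Type)
    (dT : T -> T -> R) (dU : U -> U -> R) : Prop :=
  exists (f : T -> U) (A B : R),
    [/\ 1 <= A, 0 <= B,
        forall x y, A^-1 * dT x y - B <= dU (f x) (f y)
                    /\ dU (f x) (f y) <= A * dT x y + B
      & forall u, exists x, dU (f x) u <= B].

Definition left_action (G : groupType) (M : Type) (act : G -> M -> M) : Prop :=
  (forall m, act 1%g m = m)
  /\ (forall g h m, act (g * h)%g m = act g (act h m)).

Definition right_action (L : groupType) (M : Type) (act : M -> L -> M) : Prop :=
  (forall m, act m 1%g = m)
  /\ (forall h k m, act m (h * k)%g = act (act m h) k).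

Definition measure_preserving (R : realType) (d : measure_display)
    (M : measurableType d) (rho : {measure set M -> \bar R}) (f : M -> M) : Prop :=
  measurable_fun setT f
  /\ forall A, measurable A -> rho (f @^-1` A) = rho A.

(* The next two notions apply to actions from either side, a right action
   being passed as fun h m => act m h. *)
Definition essentially_free (R : realType) (d : measure_display)
    (M : measurableType d) (rho : {measure set M -> \bar R})
    (G : groupType) (act : G -> M -> M) : Prop :=
  {ae rho, forall m, forall g, act g m = m -> g = 1%g}.

Definition fundamental_domain (R : realType) (d : measure_display)
    (M : measurableType d) (rho : {measure set M -> \bar R})
    (G : groupType) (act : G -> M -> M) (D : set M) : Prop :=
  [/\ measurable D,
      forall g h, g <> h -> rho.-negligible ((act g @` D) `&` (act h @` D))
    & rho.-negligible (~` \bigcup_g (act g @` D))].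

Definition borel_type (M : ptopologicalType) := g_sigma_algebraType (@open M).

Section Coupling.
Context (R : realType) (G L : groupType) (M : ptopologicalType).
Context (rho : {measure set (borel_type M) -> \bar R}).
Context (lact : G -> borel_type M -> borel_type M).
Context (ract : borel_type M -> L -> borel_type M).
Context (MG ML : set (borel_type M)).

Let ract' (h : L) (m : borel_type M) := ract m h.

Record measure_coupling : Prop := MeasureCoupling {
  mc_nonzero : rho setT <> 0%E;
  mc_left_action : left_action lact;
  mc_right_action : right_action ract;
  mc_commute : forall g m h, ract (lact g m) h = lact g (ract m h);
  mc_left_preserving : forall g, measure_preserving rho (lact g);
  mc_right_preserving : forall h, measure_preserving rho (ract' h);
  mc_left_free : essentially_free rho lact;
  mc_right_free : essentially_free rho ract';
  mc_left_domain : fundamental_domain rho lact MG;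
  mc_right_domain : fundamental_domain rho ract' ML;
  mc_left_finite : (rho MG < +oo)%E;
  mc_right_finite : (rho ML < +oo)%E
}.

Definition uniform_coupling : Prop :=
  (forall g : G, exists S : seq L,
     rho.-negligible ((lact g @` ML) `\` \bigcup_(s in [set` S]) (ract' s @` ML)))
  /\
  (forall h : L, exists T : seq G,
     rho.-negligible ((ract' h @` MG) `\` \bigcup_(t in [set` T]) (lact t @` MG))).

End Coupling.

Definition uniformly_measure_equivalent (R : realType) (G L : groupType) : Prop :=
  exists (M : ptopologicalType) (rho : {measure set (borel_type M) -> \bar R})
         (lact : G -> borel_type M -> borel_type M)
         (ract : borel_type M -> L -> borel_type M)
         (MG ML : set (borel_type M)),
    measure_coupling rho lact ract MG ML
    /\ uniform_coupling rho lact ract MG ML.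

(* Main.v *)
From HB Require Import structures.
From mathcomp Require Import all_boot all_order all_fingroup all_algebra.
From mathcomp Require Import all_classical all_reals all_analysis.
From mathcomp Require Import ring.
Require Import Defs.

(** Write G and L for the two groups.

    A coarse equivalence f : X -> Y between the two spaces of graphs, with
    coarse inverse g, cannot mix components far from the origin: distinct
    components are far apart and bounded sets meet finitely many components.
    So, after discarding finitely many indices, f and g restrict to maps
    f : X_i -> Y_i and g : Y_i -> X_i between matched components
    [finite_coupling_of_coarse_equivalence]. At most points these graphs look
    like Cayley graphs, so the coarse estimates on f and g become statements
    about finite subsets of the groups [finite_coupling].

    The coupling is read off from pairs (x, y) in X_i * Y_i. Such a pair is
    recorded by the two relations
      a (s, t)  iff  f (s x) = t y        b (s, t)  iff  g (t y) = s x
    on G * L, that is by a point of the compact space of subsets of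
    G * L * bool [code]. G and L act on this space by translation, and the pairs
    (x, y) are permuted accordingly, up to few bad pairs. Give each pair the
    mass 1 / |X_i|. The total mass |Y_i| is unbounded in general, but the
    set of the pairs with a (s, t) has mass 1 and the set of the pairs with b (s, t) has mass
    |Y_i| / |X_i|, which is bounded. So an ultralimit of these masses exists on
    the clopen sets that are covered by finitely many conditions a (s, t) or
    b (s, t). By compactness it is countably additive there, and it extends to a
    Borel measure rho [cube_measure_exists], which is invariant under both
    groups because the bad pairs disappear in the limit.

    For rho-almost every point [generic], a is the graph of a function G -> L
    and b, transposed, of a function L -> G, both are uniformly Lipschitz for
    the word metrics, and they are coarse inverses of each other
    [limit_measure]. This gives both conclusions. One generic point is a
    quasi-isometry [generic_quasi_isometric]. And {a (1, 1)}, the set of pairs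
    with f x = y, is a fundamental domain for L because a (1, t) holds for
    exactly one t, while {b (1, 1)} is one for G. The actions are free since
    they move these graphs, and the Lipschitz bounds say that the coupling is
    uniform [uniform_measure_coupling]. *)

Set Implicit Arguments.
Unset Strict Implicit.
Unset Printing Implicit Defensive.
Import Order.TTheory GRing.Theory Num.Theory.
Import numFieldNormedType.Exports.
Local Open Scope classical_set_scope.
Local Open Scope ring_scope.

(** * Borel measures on the space of subsets of an index set *)

Lemma countable_enum (T : Type) : countable [set: T] ->
  exists e : nat -> option T, forall x, exists n, e n = Some x.
Proof.
move=> /countable_injP[f fI].
exists (fun n => if pselect (exists x, f x = n) is left h then Some (projT1 (cid h)) else None).
move=> x; exists (f x); case: pselect => [h|[]]; last by exists x.
by case: cid => y /= fy; congr Some; apply: fI => //; rewrite inE.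
Qed.

Section cube.
Context {I : choiceType}.

Definition cube := prod_topology (fun _ : I => bool).
HB.instance Definition _ := Pointed.on cube.
HB.instance Definition _ := Topological.on cube.

Definition touching (s : seq I) : set cube := [set w | has (fun i => w i) s].
Definition containing (s : seq I) : set cube := [set w | all (fun i => w i) s].

(** The sets on which the limit of the counting measures is finite: they stay
    away from the empty subset of I, near which infinite mass may accumulate. *)
Definition bounded_clopen : set (set cube) :=
  [set A | clopen A /\ exists s, A `<=` touching s].

Lemma clopen_coordinate i (A : set bool) : clopen [set w : cube | A (w i)].
Proof.
apply: (@preimage_clopen cube bool (fun w => w i)); last first.
  by move=> w; exact: (@proj_continuous I (fun=> bool) i w).
by split; [exact: discrete_open|exact: discrete_closed].
Qed.

Lemma clopen_touching s : clopen (touching s).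
Proof.
elim: s => [|i s IH].
  rewrite (_ : touching [::] = set0); first exact: clopen0.
  by apply/seteqP; split.
rewrite (_ : touching _ = [set w : cube | w i] `|` touching s).
  by apply: clopenU => //; exact: (clopen_coordinate i (fun b => b)).
by apply/seteqP; split=> w /=; rewrite /touching/=; [move/orP|move=> H; apply/orP].
Qed.

Lemma clopen_containing s : clopen (containing s).
Proof.
elim: s => [|i s IH].
  rewrite (_ : containing [::] = setT); first exact: clopenT.
  by apply/seteqP; split.
rewrite (_ : containing _ = [set w : cube | w i] `&` containing s).
  by apply: clopenI => //; exact: (clopen_coordinate i (fun b => b)).
by apply/seteqP; split=> w /=; rewrite /containing/=; [move/andP|move=> H; apply/andP].
Qed.

Lemma bounded_clopen_containing s : s != [::] -> bounded_clopen (containing s).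
Proof.
case: s => // i s _; split; first exact: clopen_containing.
by exists [:: i] => w /= /andP[wi _]; rewrite /touching/= wi.
Qed.

Lemma bounded_clopen0 : bounded_clopen set0.
Proof. by split; [exact: clopen0|exists [::]]. Qed.

Lemma bounded_clopenU : setU_closed bounded_clopen.
Proof.
move=> A B [cA [s As]] [cB [t Bt]]; split; first exact: clopenU.
exists (s ++ t) => w [/As|/Bt]; rewrite /touching/= has_cat => ->//.
by rewrite orbT.
Qed.

Lemma bounded_clopenD : setD_closed bounded_clopen.
Proof.
move=> A B [cA [s As]] [cB _]; split.
  by rewrite setDE; apply: clopenI => //; exact: clopenC.
by exists s; apply: subset_trans As; exact: subDsetl.
Qed.

Lemma compact_cube : compact [set: cube].
Proof.
have := @tychonoff I (fun=> bool) (fun=> setT) (fun=> bool_compact).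
by congr (compact _); rewrite eqEsubset.
Qed.

(** The sets of points agreeing with w on a finite set of indices form a filter
    base that converges to w coordinatewise, hence in the product topology. *)
Lemma cube_nbhs (w : cube) (A : set cube) : nbhs w A ->
  exists s : seq I, [set v : cube | forall i, i \in s -> v i = w i] `<=` A.
Proof.
pose B (s : seq I) := [set v : cube | forall i, i \in s -> v i = w i].
have FF : Filter (filter_from setT B).
  apply: filter_from_filter; first by exists [::].
  move=> s t _ _; exists (s ++ t) => // v vst.
  by split=> i si; apply: vst; rewrite mem_cat si ?orbT.
suff : filter_from setT B --> (w : cube).
  by move=> Fw nA; have [s _ sA] := Fw _ nA; exists s.
apply/(@cvg_sup _ I (fun i => Topological.class
    (initial_topology (fun f : (forall i : I, bool) => f i)))) => i.
apply/cvg_image; first by rewrite eqEsubset; split=> // b _; exists (fun=> b).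
move=> V /= /nbhs_singleton Vw; exists (@proj I (fun=> bool) i @^-1` V).
  exists [:: i] => // v vi; rewrite /= /proj vi ?mem_seq1//.
rewrite eqEsubset; split; first exact: image_preimage_subset.
by move=> b Vb; exists (fun=> b).
Qed.

End cube.
Arguments cube : clear implicits.

(** An alias of the space that carries the ring of bounded clopen sets, to which
    the extension theorem for measures on semirings of sets applies. *)
Definition cube_ring (I : choiceType) : Type := cube I.
HB.instance Definition _ I := Pointed.on (cube_ring I).

Section cube_ring.
Context {I : choiceType}.
HB.instance Definition _ := @isRingOfSets.Build default_measure_display
  (cube_ring I) (@bounded_clopen I) bounded_clopen0 bounded_clopenU bounded_clopenD.
End cube_ring.

(** An open set is the union of the cylinders that it contains, and there are
    countably many cylinders when I is countable. *)
Lemma open_sigma_algebra (I : choiceType) (S : set (set (cube I))) :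
  countable [set: I] -> sigma_algebra setT S ->
  (forall i, S (containing [:: i])) -> @open (cube I) `<=` S.
Proof.
move=> /countable_enum[e eI] [sig0 sigD sigU] Si A oA.
have sigC B : S B -> S (~` B) by move=> SB; rewrite -setTD; exact: sigD.
have sI (B C : set (cube I)) : S B -> S C -> S (B `&` C).
  move=> SB SC; rewrite -[_ `&` _]setCK setCI -bigcup2E; apply: (sigC (bigcup _ _)).
  by apply: sigU => -[|[|n]] //=; exact: sigC.
pose P (nb : nat * bool) := if e nb.1 is Some i then [set w : cube I | w i = nb.2] else setT.
have sT : S setT by rewrite -setC0; exact: sigC.
have sP nb : S (P nb).
  rewrite /P; case: (e _) => // i.
  have H : S [set w : cube I | w i].
    rewrite (_ : [set w | _] = containing [:: i])//.
    by apply/seteqP; split => w; rewrite /containing/= andbT.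
  case: nb.2; first exact: H.
  rewrite (_ : [set w | _] = ~` [set w : cube I | w i]); first exact: sigC.
  by apply/seteqP; split=> w /=; [move=> ->|move=> /negP/negbTE].
pose Q (s : seq (nat * bool)) := [set w : cube I | forall nb, nb \in s -> P nb w].
have sQ s : S (Q s).
  elim: s => [|nb s IH].
    by rewrite (_ : Q _ = setT)//; apply/seteqP; split.
  rewrite (_ : Q _ = P nb `&` Q s); first exact: sI.
  apply/seteqP; split=> w.
    by move=> Qw; split=> [|nb' nbs]; apply: Qw; rewrite inE ?eqxx ?nbs ?orbT.
  by move=> [Pw Qw] nb'; rewrite inE => /predU1P[->//|/Qw].
have [dec decK] : exists dec : nat -> seq (nat * bool),
    forall s, exists n, dec n = s.
  exists (fun n => odflt [::] (choice.unpickle n)) => s.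
  by exists (choice.pickle s); rewrite choice.pickleK.
pose F n : set (cube I) := if pselect (Q (dec n) `<=` A) then Q (dec n) else set0.
have -> : A = \bigcup_n F n.
  apply/seteqP; split; last first.
    by move=> w [n _]; rewrite /F; case: pselect => // QA; exact: QA.
  move=> w Aw; have [|s sA] := @cube_nbhs I w A; first exact: open_nbhs_nbhs.
  have [f fe] : exists f : I -> nat, forall i, e (f i) = Some i.
    by exists (fun i => projT1 (cid (eI i))) => i; case: cid.
  pose t := [seq (f i, w i) | i <- s].
  have Qw : Q t w by move=> nb /mapP[i si ->]; rewrite /P fe.
  have QA : Q t `<=` A.
    move=> v Qv; apply: sA => i si.
    by have := Qv (f i, w i) (map_f _ si); rewrite /P fe.
  by have [n nt] := decK t; exists n => //; rewrite /F nt; case: pselect.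
by apply: sigU => n; rewrite /F; case: pselect => H; [exact: sQ|exact: sig0].
Qed.

Lemma closed_cube_zero (I : choiceType) : @closed (cube I) [set (fun=> false)].
Proof.
rewrite (_ : [set _] = \bigcap_i ~` [set w : cube I | w i]).
  by apply: closed_bigI => i _; apply: open_closedC; case: (clopen_coordinate i (fun b => b)).
apply/seteqP; split=> [w -> i _ //|w wi].
by apply/funext => i; have /negP/negbTE := wi i Logic.I.
Qed.

Lemma measurable_cube_zero (I : choiceType) :
  measurable ([set (fun=> false)] : set (borel_type (cube I))).
Proof.
rewrite -[X in measurable X]setCK; apply: measurableC.
by apply: sub_sigma_algebra; rewrite openC; exact: closed_cube_zero.
Qed.

Section cube_measure.
Context {R : realType} {I : choiceType} (m : set (cube I) -> R).
Hypothesis m_ge0 : forall A, 0 <= m A.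
Hypothesis mU : forall A B, bounded_clopen A -> bounded_clopen B ->
  A `&` B = set0 -> m (A `|` B) = m A + m B.

Let mu (A : set (cube_ring I)) : \bar R := (m A)%:E.

Let mu0 : mu set0 = 0%E.
Proof.
have := mU bounded_clopen0 bounded_clopen0 (setI0 set0).
rewrite setU0 => /(congr1 (fun x => x - m set0)).
by rewrite addrK subrr /mu => <-.
Qed.

Let mu_ge0 A : (0 <= mu A)%E.
Proof. by rewrite lee_fin. Qed.

Let mu_additive : measure_function.semi_additive mu.
Proof.
apply/(measure_function.additive2P mu0) => A B mA mB AB.
by rewrite /mu mU.
Qed.

HB.instance Definition _ := isContent.Build _ _ _ mu mu_ge0 mu_additive.

Let mu_sub : measurable_subset_sigma_subadditive mu.
Proof.
move=> A F mF mA AF.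
have [n An] : exists n, A `<=` \big[setU/set0]_(k < n) F k.
  have : compact (A : set (cube I)).
    by apply: (subclosed_compact _ compact_cube) => //; case: mA => -[].
  rewrite compact_cover => /(_ nat setT (fun n => F n)).
  case; [by move=> i _; case: (mF i) => -[]|by []|].
  move=> D _ AD; exists (\max_(k <- finmap.enum_fset D) k).+1 => w /AD [k /= kD Fk].
  rewrite -bigcup_mkord; exists k => //=.
  by rewrite ltnS; apply: (@leq_bigmax_seq _ _ predT (fun k => k)).
apply: le_trans (nneseries_lim_ge n _); last by move=> *; exact: mu_ge0.
rewrite big_mkord.
exact: (@content_subadditive _ _ _ mu).
Qed.

HB.instance Definition _ := Content_SigmaSubAdditive_isMeasure.Build _ _ _ mu mu_sub.

Hypothesis cI : countable [set: I].

Let ext := measure_extension mu.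

Let id_measurable : measurable_fun setT
  (fun w : g_sigma_algebraType (@measurable _ (cube_ring I)) => w : borel_type (cube I)).
Proof.
apply: (@measurability _ _ _ (borel_type (cube I)) setT _ (@open (cube I)) erefl).
move=> _ [A oA <-]; rewrite setTI; apply: open_sigma_algebra oA => //.
  exact: smallest_sigma_algebra.
by move=> i; apply: sub_sigma_algebra; exact: bounded_clopen_containing.
Qed.

Let nonzero : set (borel_type (cube I)) := ~` [set (fun=> false)].

Let nonzero_measurable : measurable nonzero.
Proof. by apply: measurableC; exact: measurable_cube_zero. Qed.

(** A clopen set is compact, so a countable cover of it by bounded clopen sets is
    in effect finite: every finitely additive m is a premeasure and extends. The
    extension is restricted to the complement of the zero point, which no
    countable family of bounded sets covers. *)
Lemma cube_measure_exists :
  exists rho : {measure set (borel_type (cube I)) -> \bar R},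
    (forall A, bounded_clopen A -> rho A = (m A)%:E) /\ rho [set (fun=> false)] = 0%E.
Proof.
exists (mrestr (pushforward ext (fun w => w : borel_type (cube I)))
  nonzero_measurable); split; last first.
  by transitivity (ext set0); [congr (ext _); exact: setICr|exact: measure0].
move=> A [cA [s As]]; transitivity (ext A); last first.
  rewrite /ext /measure_extension measurable_mu_extE//.
  by split=> //; exists s.
congr (ext _); apply/seteqP; split=> [w []//|w Aw]; split=> // w0.
by move: (As _ Aw); rewrite w0 /touching/=; elim: (s).
Unshelve. exact: id_measurable.
Qed.
End cube_measure.

Lemma bounded_clopen_measurable (I : choiceType) (A : set (borel_type (cube I))) :
  bounded_clopen A -> measurable A.
Proof. by move=> [[oA _] _]; exact: sub_sigma_algebra. Qed.

(** The sets [containing s] with s nonempty are stable under intersection, and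
    with the zero point they cover the space. *)
Lemma cube_measure_unique (R : realType) (I : choiceType)
    (m1 m2 : {measure set (borel_type (cube I)) -> \bar R}) :
  countable [set: I] ->
  m1 [set (fun=> false)] = 0%E -> m2 [set (fun=> false)] = 0%E ->
  (forall i, (m1 (containing [:: i]) < +oo)%E) ->
  (forall s, s != [::] -> m1 (containing s) = m2 (containing s)) ->
  forall A, measurable A -> m1 A = m2 A.
Proof.
move=> cI m10 m20 fin m12.
have [e eI] := countable_enum cI.
pose z : set (cube I) := [set (fun=> false)].
pose G : set (set (cube I)) := [set A | [\/ A = set0, A = z |
  exists2 s, s != [::] & A = containing s]].
pose g n : set (cube I) := if n is n.+1 then
  if e n is Some i then containing [:: i] else set0 else z.
have Gg n : G (g n).
  case: n => [|n]; first by apply: Or32.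
  by rewrite /g; case: (e n) => [i|]; [apply: Or33; exists [:: i]|apply: Or31].
have zs s : s != [::] -> z `&` containing s = set0.
  case: s => // i s _; apply/seteqP; split=> // w [-> ].
  by rewrite /containing.
move=> A mA; apply: (@measure_unique _ R (borel_type (cube I)) G g
  _ _ Gg _ m1 m2) => // {A mA}.
- apply/seteqP; split.
  + apply: smallest_sub.
      exact: smallest_sigma_algebra.
    apply: open_sigma_algebra => [//||i]; first exact: smallest_sigma_algebra.
    by apply: sub_sigma_algebra; apply: Or33; exists [:: i].
  + apply: smallest_sub; first exact: smallest_sigma_algebra.
    move=> A [->|->|[s s0 ->]].
    * exact: measurable0.
    * exact: measurable_cube_zero.
    * apply: bounded_clopen_measurable; exact: bounded_clopen_containing.
- move=> A B [->|->|[s s0 ->]] [->|->|[t t0 ->]]; rewrite ?set0I ?setI0 ?setIid;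
    try (by apply: Or31); try (by apply: Or32).
  + by rewrite zs//; apply: Or31.
  + by rewrite setIC zs//; apply: Or31.
  + apply: Or33; exists (s ++ t); first by case: (s) s0.
    by apply/seteqP; split=> w; rewrite /containing/= all_cat;
      [move=> [-> ->]|move/andP].
- apply/seteqP; split=> // w _.
  have [[i wi]|nw] := pselect (exists i, w i).
    have [n ni] := eI i; exists n.+1 => //; rewrite /g ni.
    by rewrite /containing/= wi.
  exists 0%N => //; apply/funext => i; apply/negbTE/negP => wi.
  by apply: nw; exists i.
- by move=> A [->|->|[s s0 ->]]; rewrite ?measure0 ?m10 ?m20//; exact: m12.
- case=> [|n]; first by rewrite /g m10.
  by rewrite /g; case: (e n) => [i|]; rewrite ?measure0.
Qed.

(** * Almost actions at good points and finite couplings *)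

Section good_points.
Context {G : groupType} {V : finType} (sigma : G -> {perm V}).
Implicit Types (F : seq G) (x : V).

Definition good F x : bool :=
  all (fun g => all (fun h => sigma g (sigma h x) == sigma (g * h)%g x) F) F
  && all (fun g => (g == 1%g) || (sigma g x != x)) F.

Lemma good_sub F F' x : {subset F <= F'} -> good F' x -> good F x.
Proof.
move=> FF' /andP[/allP m /allP fr]; apply/andP; split.
  by apply/allP => g /FF'/m/allP mg; apply/allP => h /FF'; exact: mg.
by apply/allP => g /FF'; exact: fr.
Qed.

Lemma good_mul F x g h : good F x -> g \in F -> h \in F ->
  sigma g (sigma h x) = sigma (g * h)%g x.
Proof. by move=> /andP[/allP m _] /m/allP mg /mg/eqP. Qed.

Lemma good_one F x : good F x -> 1%g \in F -> sigma 1%g x = x.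
Proof.
by move=> Fx F1; apply: (@perm_inj _ (sigma 1%g)); rewrite (good_mul Fx)// mulg1.
Qed.

(** Here freeness of h^-1 g at x is used; the list collects the elements needed to
    rewrite sigma (h^-1 g) x as sigma (h^-1) (sigma h x) = x. *)
Lemma good_inj F x g h : good F x ->
  {subset [:: 1; g; h; h^-1; h^-1 * g]%g <= F} ->
  sigma g x = sigma h x -> g = h.
Proof.
move=> Fx sF e.
have [F1 Fg Fh Fh' Fhg] : [/\ 1 \in F, g \in F, h \in F, h^-1 \in F
    & h^-1 * g \in F]%g.
  by split; apply: sF; rewrite !inE eqxx ?orbT.
have : sigma (h^-1 * g)%g x = x.
  rewrite -(good_mul Fx)// e (good_mul Fx)// mulVg; exact: (good_one Fx).
move=> e'; have /andP[_ /allP/(_ _ Fhg)] := Fx.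
rewrite e' eqxx orbF => /eqP hg.
by apply/esym; apply: (mulgI h^-1%g); rewrite hg mulVg.
Qed.

End good_points.

Section small.
Context (R : realType) {V : nat -> finType}.

(** Density tending to 0 along the sequence V. *)
Definition small (P : forall i, pred (V i)) : Prop :=
  forall eps : R, 0 < eps -> exists N : nat, forall i, (N <= i)%N ->
    #|P i|%:R <= eps * #|V i|%:R.

Lemma smallU P Q : small P -> small Q -> small (fun i => [pred x | P i x || Q i x]).
Proof.
move=> sP sQ e e0; have e20 : 0 < e / 2 by rewrite divr_gt0.
have [M HM] := sP _ e20; have [N HN] := sQ _ e20.
exists (maxn M N) => i; rewrite geq_max => /andP[/HM HP /HN HQ].
rewrite [e]splitr mulrDl; apply: le_trans (lerD HP HQ).
rewrite -natrD ler_nat.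
have <- : #|[predU P i & Q i]| = #|[pred x | P i x || Q i x]|.
  by apply: eq_card => x.
by rewrite -cardUI leq_addr.
Qed.

Lemma small_perm P (s : forall i, {perm V i}) : small P ->
  small (fun i => [pred x | P i (s i x)]).
Proof.
move=> sP e e0; have [N HN] := sP _ e0; exists N => i /HN; apply: le_trans.
rewrite ler_nat -(card_imset _ (@perm_inj _ (s i))).
apply: subset_leq_card; apply/fintype.subsetP => y /imsetP[x]; rewrite !inE => Px ->.
exact: Px.
Qed.

End small.

Section finite_coupling.
Context (R : realType).

Definition almost_free (G : groupType) (X : nat -> finType)
    (sigma : forall i, G -> {perm X i}) : Prop :=
  forall F : seq G, small R (fun i => [pred x | ~~ good (sigma i) F x]).

(** Coarse control of f, expressed in the groups: at good points the displacement of
    x by h is followed by a displacement of f x within a finite set B depending only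
    on h. *)
Definition controlled (G L : groupType) (X Y : nat -> finType)
    (sigma : forall i, G -> {perm X i}) (tau : forall i, L -> {perm Y i})
    (f : forall i, X i -> Y i) : Prop :=
  forall h : G, exists (F : seq G) (F' B : seq L), forall i x,
    good (sigma i) F x -> good (tau i) F' (f i x) ->
    exists2 b, b \in B & f i (sigma i h x) = tau i b (f i x).

Definition almost_inverse (G : groupType) (X Y : nat -> finType)
    (sigma : forall i, G -> {perm X i})
    (f : forall i, X i -> Y i) (g : forall i, Y i -> X i) : Prop :=
  exists F B : seq G, forall i x, good (sigma i) F x ->
    exists2 b, b \in B & g i (f i x) = sigma i b x.

Definition uniformly_finite_to_one (X Y : nat -> finType)
    (f : forall i, X i -> Y i) : Prop :=
  exists N : nat, forall i y, (#|[pred x | f i x == y]| <= N)%N.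

(** What a coarse equivalence between two spaces of graphs leaves on the matched
    components. The notion is symmetric, so each fact about f also serves
    for g. *)
Record finite_coupling (G L : groupType) (X Y : nat -> finType)
    (sigma : forall i, G -> {perm X i}) (tau : forall i, L -> {perm Y i})
    (f : forall i, X i -> Y i) (g : forall i, Y i -> X i) : Prop :=
  FiniteCoupling {
    fc_nonempty : forall i, (0 < #|X i|)%N;
    fc_free : almost_free sigma;
    fc_free' : almost_free tau;
    fc_ctrl : controlled sigma tau f;
    fc_ctrl' : controlled tau sigma g;
    fc_inv : almost_inverse sigma f g;
    fc_inv' : almost_inverse tau g f;
    fc_fin : uniformly_finite_to_one f;
    fc_fin' : uniformly_finite_to_one g }.

Lemma finite_coupling_sym G L X Y sigma tau f g :
  @finite_coupling G L X Y sigma tau f g ->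
  @finite_coupling L G Y X tau sigma g f.
Proof.
move=> [ne ? ? ? ? ? ? ? ?]; split => // i.
by have /card_gt0P[x _] := ne i; apply/card_gt0P; exists (f i x).
Qed.

Section local_facts.
Context (G L : groupType) (X Y : nat -> finType)
    (sigma : forall i, G -> {perm X i}) (tau : forall i, L -> {perm Y i})
    (f : forall i, X i -> Y i) (g : forall i, Y i -> X i).
Hypothesis fc : finite_coupling sigma tau f g.

(** Smallness in X i and in Y i are therefore comparable. *)
Lemma card_le_fibres : exists N : nat, forall i, (#|Y i| <= N * #|X i|)%N.
Proof.
have [N HN] := fc_fin' fc; exists N => i.
rewrite -[#|Y i|]sum1_card (partition_big (@g i) predT)//= mulnC -sum_nat_const.
by apply: leq_sum => x _; rewrite sum1_card; exact: HN.
Qed.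

(** Families of sets of pairs whose mass vanishes in the limit, each pair weighing
    1 / |X i|. *)
Definition scarce (P : forall i, X i -> Y i -> bool) : Prop :=
  forall eps : R, 0 < eps -> exists N : nat, forall i, (N <= i)%N ->
    #|[pred p : X i * Y i | P i p.1 p.2]|%:R <= eps * #|X i|%:R.

(** On the graph of f (up to permutations alpha and beta) x determines y, and y leaves
    boundedly many choices for x; so a small set of bad x or y spoils few pairs. *)
Lemma scarce_graph (P : forall i, pred (X i)) (Q : forall i, pred (Y i))
    (alpha : forall i, {perm X i}) (beta : forall i, {perm Y i}) :
  small R P -> small R Q ->
  scarce (fun i x y => (f (alpha i x) == beta i y) && (P i x || Q i y)).
Proof.
move=> sP sQ e e0.
have [N HN] := fc_fin fc; have [C HC] := card_le_fibres.
have e20 : 0 < e / 2 by rewrite divr_gt0.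
have [M1 HM1] := sP _ e20.
(* The bad y number at most e / (2 D) times |Y i|, hence spoil at most
   N C e / (2 D) <= e / 2 times |X i| pairs. *)
pose D : R := (N * C).+1%:R.
have D0 : 0 < D by rewrite ltr0n.
have [M2 HM2] : exists M, forall i, (M <= i)%N -> #|Q i|%:R <= e / 2 / D * #|Y i|%:R.
  by apply: sQ; rewrite divr_gt0.
exists (maxn M1 M2) => i; rewrite geq_max => /andP[/HM1 {}HM1 /HM2 {}HM2].
have H : (#|[pred p : X i * Y i | (f (alpha i p.1) == beta i p.2)
                           && (P i p.1 || Q i p.2)]| <= #|P i| + N * #|Q i|)%N.
  apply: (@leq_trans (#|[pred p : X i * Y i | (f (alpha i p.1) == beta i p.2) && P i p.1]|
      + #|[pred p : X i * Y i | (f (alpha i p.1) == beta i p.2) && Q i p.2]|)).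
    rewrite -cardUI; apply: leq_trans (leq_addr _ _).
    apply: subset_leq_card; apply/fintype.subsetP => -[x y].
    by rewrite !inE /= -andb_orr.
  apply: leq_add.
    have inj : {in [pred p : X i * Y i | (f (alpha i p.1) == beta i p.2) && P i p.1] &,
        injective fst}.
      move=> [x y] [x' y'] /andP[/= /eqP e1 _] /andP[/= /eqP e2 _] xx'.
      by move: e2; rewrite -xx' e1 => /perm_inj ->.
    rewrite -(card_in_imset inj); apply: subset_leq_card.
    by apply/fintype.subsetP => x /imsetP[[x' y]]; rewrite inE => /andP[_ /= Px'] ->.
  rewrite -[leqLHS]sum1_card [leqLHS]big_mkcond/=.
  rewrite -(pair_bigA _ (fun x y =>
    if (f (alpha i x) == beta i y) && Q i y then 1 else 0)%N)/= exchange_big/=.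
  rewrite mulnC -sum_nat_const [leqRHS]big_mkcond/=.
  apply: leq_sum => y _; rewrite -big_mkcond/= sum1_card.
  case: ifPn => Qy; last first.
    by rewrite eq_card0// => x; apply/negP => /andP[_]; exact/negP.
  apply: leq_trans (HN i (beta i y)).
  rewrite -(card_imset _ (@perm_inj _ (alpha i))); apply: subset_leq_card.
  by apply/fintype.subsetP => x /imsetP[x' /andP[e' _] ->].
apply: (@le_trans _ _ (#|P i| + N * #|Q i|)%:R); first by rewrite ler_nat.
rewrite natrD [e in e * _]splitr mulrDl lerD// natrM.
have Y0 : (#|Y i|%:R : R) <= C%:R * #|X i|%:R by rewrite -natrM ler_nat.
apply: (@le_trans _ _ (N%:R * (e / 2 / D * (C%:R * #|X i|%:R)))).
  by rewrite ler_wpM2l//; apply: le_trans HM2 _; rewrite ler_wpM2l// divr_ge0// ltW.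
have -> : N%:R * (e / 2 / D * (C%:R * #|X i|%:R)) = ((N * C)%:R / D) * (e / 2 * #|X i|%:R).
  by rewrite natrM; ring.
rewrite ler_piMl//; first by rewrite mulr_ge0// ltW.
by rewrite ler_pdivrMr// mul1r ler_nat.
Qed.

End local_facts.

Lemma scarce_sym (G L : groupType) (X Y : nat -> finType)
    (sigma : forall i, G -> {perm X i}) (tau : forall i, L -> {perm Y i})
    (f : forall i, X i -> Y i) (g : forall i, Y i -> X i)
    (P : forall i, X i -> Y i -> bool) :
  finite_coupling sigma tau f g ->
  scarce (fun i y x => P i x y) -> scarce P.
Proof.
move=> fc sP e e0; have [C HC] := card_le_fibres fc.
have D0 : 0 < C.+1%:R :> R by [].
have eD0 : 0 < e / C.+1%:R by rewrite divr_gt0.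
have [N HN] := sP _ eD0; exists N => i /HN {}HN.
have -> : #|[pred p : X i * Y i | P i p.1 p.2]| =
    #|[pred p : Y i * X i | P i p.2 p.1]|.
  have sw : injective (fun p : X i * Y i => (p.2, p.1)) by move=> [x y] [x' y'] [-> ->].
  rewrite -(card_imset _ sw); apply: eq_card => -[y x]; rewrite !inE /=.
  apply/imsetP/idP => [[[x' y']]|Pxy]; first by rewrite inE => /= ? [-> ->].
  by exists (x, y) => //; rewrite inE.
apply: le_trans HN _; rewrite -mulrA ler_wpM2l ?(ltW e0)// mulrC ler_pdivrMr//.
rewrite -natrM ler_nat mulnC; apply: leq_trans (HC i) _.
by rewrite leq_mul2r leqnSn orbT.
Qed.

End finite_coupling.

(** * Ultralimits of the counting measures *)

Section ultralimit.
Context (U : set_system nat) (UU : UltraFilter U).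

(** A cluster point of an ultrafilter is a limit: the preimage of a neighbourhood
    or its complement belongs to U. *)
Lemma ultra_bounded_cvg (R : realType) (u : nat -> R) (M : R) :
  (forall i, `|u i| <= M) -> cvg (u @ U).
Proof.
move=> uM.
have uK : (u @ U) [set` `[- M, M]].
  by apply: (@filterS _ U _ setT) => [i _|]; [rewrite /= in_itv/= -ler_norml|exact: filterT].
have [l [_ cl]] := @segment_compact R (- M) M (u @ U) _ uK.
apply/cvg_ex; exists l => V nV.
have [//|nUV] := in_ultra_setVsetC (u @^-1` V) UU.
have [r [/= ? ?]] := cl (~` V) V nUV nV; contradiction.
Qed.

End ultralimit.

Section limit_mass.
Context (R : realType) (G L : groupType) (X Y : nat -> finType)
    (sigma : forall i, G -> {perm X i}) (tau : forall i, L -> {perm Y i})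
    (f : forall i, X i -> Y i) (g : forall i, Y i -> X i).
Hypothesis fc : finite_coupling R sigma tau f g.
Context (U : set_system nat) (UU : UltraFilter U) (Uoo : \oo `<=` U).

Notation index := (G * L * bool)%type.

(** The position of y relative to x, as a subset of G * L * bool: the triples
    (s, t, false) with f (s x) = t y and (s, t, true) with g (t y) = s x. *)
Definition code i (x : X i) (y : Y i) : cube index := fun p =>
  if p.2 then g (tau i p.1.2 y) == sigma i p.1.1 x
         else f (sigma i p.1.1 x) == tau i p.1.2 y.

Definition count i (A : set (cube index)) : nat :=
  #|[pred p : X i * Y i | `[< A (code p.1 p.2) >]]|.

Definition freq i (A : set (cube index)) : R := (count i A)%:R / #|X i|%:R.

Let X0 i : 0 < #|X i|%:R :> R. Proof. by rewrite ltr0n; exact: (fc_nonempty fc). Qed.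

Lemma freq_ge0 i A : 0 <= freq i A.
Proof. exact: divr_ge0. Qed.

Lemma le_freq i A B : A `<=` B -> freq i A <= freq i B.
Proof.
move=> AB; rewrite ler_pM2r ?invr_gt0// ler_nat.
apply: subset_leq_card; apply/fintype.subsetP => p; rewrite !unfold_in/= => /asboolP Ap.
by apply/asboolP; exact: AB.
Qed.

Lemma freqU i A B : A `&` B = set0 -> freq i (A `|` B) = freq i A + freq i B.
Proof.
move=> AB; rewrite -mulrDl -natrD -cardUI.
rewrite [X in (_ + X)%N]eq_card0 ?addn0; last first.
  move=> p; rewrite !unfold_in/=; apply/negP => /andP[/asboolP Ap /asboolP Bp].
  by have : (A `&` B) (code p.1 p.2) by []; rewrite AB.
congr (_%:R / _); apply: eq_card => p; rewrite !unfold_in/=.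
by apply/asboolP/orP => -[/asboolP|/asboolP]; [left|right|left|right].
Qed.

(** A condition of the first kind holds for at most |X i| pairs, as x determines y;
    one of the second kind for at most |Y i| pairs, and |Y i| is bounded by a multiple
    of |X i|. *)
Lemma freq_le_bound : exists2 D : R, 0 < D &
  forall i s, freq i (touching s) <= (size s)%:R * D.
Proof.
have [C HC] := card_le_fibres fc.
exists C.+1%:R => // i; elim=> [|[[a b] c] s IH].
  rewrite mul0r /freq /count eq_card0 ?mul0r// => p; rewrite !unfold_in/=.
  by apply/asboolP.
have -> : touching ((a, b, c) :: s) = touching [:: (a, b, c)] `|` touching s.
  by apply/seteqP; split=> w; rewrite /touching/= orbF;
     [move/orP|move=> H; apply/orP].
apply: (@le_trans _ _ (freq i (touching [:: (a, b, c)]) + freq i (touching s))).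
  rewrite -mulrDl ler_pM2r ?invr_gt0// -natrD ler_nat /count -cardUI.
  apply: leq_trans (leq_addr _ _).
  apply: subset_leq_card; apply/fintype.subsetP => p; rewrite !unfold_in/=.
  by move=> /asboolP[]H; apply/orP; [left|right]; apply/asboolP.
rewrite /= -[X in X * _]natr1 addrC mulrDl mul1r lerD//.
rewrite /freq ler_pdivrMr// -natrM ler_nat /count.
case: c; last first.
  apply: (@leq_trans #|X i|); last by rewrite leq_pmull.
  have inj : {in [pred p : X i * Y i | `[< touching [:: (a, b, false)] (code p.1 p.2) >]] &,
      injective fst}.
    move=> [x y] [x' y']; rewrite !unfold_in/= /touching/= !orbF /code/=.
    move=> /asboolP/eqP e1 /asboolP/eqP e2 xx'.
    by move: e2; rewrite -xx' e1 => /perm_inj ->.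
  by rewrite -(card_in_imset inj); exact: max_card.
apply: (@leq_trans #|Y i|); last first.
  by apply: leq_trans (HC i) _; rewrite leq_mul2r leqnSn orbT.
have inj : {in [pred p : X i * Y i | `[< touching [:: (a, b, true)] (code p.1 p.2) >]] &,
    injective snd}.
  move=> [x y] [x' y']; rewrite !unfold_in/= /touching/= !orbF /code/=.
  move=> /asboolP/eqP e1 /asboolP/eqP e2 yy'.
  by move: e2; rewrite -yy' e1 => /perm_inj ->.
by rewrite -(card_in_imset inj); exact: max_card.
Qed.

Lemma freq_graph i (a : G) (b : L) : freq i (containing [:: (a, b, false)]) = 1.
Proof.
rewrite /freq /count (_ : #|_| = #|X i|) ?divff ?gt_eqF//.
have inj : injective (fun x : X i => (x, (tau i b)^-1%g (f (sigma i a x)))).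
  by move=> x x' [].
rewrite -[RHS](card_imset _ inj); apply: eq_card => -[x y].
rewrite !unfold_in/= /containing/= andbT /code/=; apply/asboolP/imsetP => /=.
  by move=> /eqP e; exists x; rewrite // e permK.
by move=> [x' _ [-> ->]]; rewrite permKV.
Qed.

(** The absolute value makes the mass nonnegative also where no limit exists. *)
Definition mass (A : set (cube index)) : R := `|lim (freq ^~ A @ U)|.

Lemma mass_ge0 A : 0 <= mass A. Proof. exact: normr_ge0. Qed.

Lemma mass_cvg A : bounded_clopen A -> freq ^~ A @ U --> mass A.
Proof.
move=> [_ [s As]]; have [D _ HD] := freq_le_bound.
have c : cvg (freq ^~ A @ U).
  apply: (@ultra_bounded_cvg U UU R _ ((size s)%:R * D)) => i.
  by rewrite ger0_norm ?freq_ge0//; apply: le_trans (HD i s); exact: le_freq.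
have l0 : 0 <= lim (freq ^~ A @ U).
  by apply: (limr_ge c); apply: nearW => i; exact: freq_ge0.
by rewrite /mass ger0_norm.
Qed.

Lemma massU A B : bounded_clopen A -> bounded_clopen B -> A `&` B = set0 ->
  mass (A `|` B) = mass A + mass B.
Proof.
move=> bA bB AB; apply: (@cvg_unique _ (@Rhausdorff R) (freq ^~ (A `|` B) @ U)).
  by apply: mass_cvg; exact: bounded_clopenU.
rewrite (_ : freq ^~ _ = freq ^~ A \+ freq ^~ B).
  by apply: cvgD; exact: mass_cvg.
by apply/funext => i /=; rewrite freqU.
Qed.

Lemma mass_graph (a : G) (b : L) : mass (containing [:: (a, b, false)]) = 1.
Proof.
apply: (@cvg_unique _ (@Rhausdorff R) (freq ^~ (containing [:: (a, b, false)]) @ U)).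
  by apply: mass_cvg; exact: bounded_clopen_containing.
by apply: cvg_near_cst; apply: nearW => i; rewrite freq_graph.
Qed.

(** Comparison of masses after moving the pairs by permutations, up to a scarce
    exceptional set: this gives invariance, and nullity when B is empty. *)
Lemma le_mass A B (P : forall i, X i -> Y i -> bool) (a : forall i, {perm X i})
    (b : forall i, {perm Y i}) :
  bounded_clopen A -> bounded_clopen B -> scarce R P ->
  (forall i x y, A (code (a i x) (b i y)) -> ~~ P i x y -> B (code x y)) ->
  mass A <= mass B.
Proof.
move=> bA bB sP AB; apply/ler_addgt0Pr => e e0.
have [N HN] := sP _ e0.
have cBA : (fun i => freq i B + e - freq i A) @ U --> mass B + e - mass A.
  apply: cvgB; last exact: mass_cvg.
  by apply: cvgD; [exact: mass_cvg|exact: cvg_cst].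
rewrite -subr_ge0; apply: (cvgr_to_ge cBA).
apply: Uoo; exists N => // i /= /HN {}HN; rewrite subr_ge0/=.
rewrite /freq ler_pdivrMr// mulrDl mulfVK ?gt_eqF//.
apply: le_trans (lerD (lexx _) HN); rewrite -natrD ler_nat /count -cardUI.
apply: leq_trans (leq_addr _ _).
have inj : injective (fun p : X i * Y i => (a i p.1, b i p.2)).
  by move=> [x y] [x' y'] [/perm_inj -> /perm_inj ->].
rewrite -[leqRHS](card_imset _ inj); apply: subset_leq_card.
apply/fintype.subsetP => -[x' y']; rewrite unfold_in/= => /asboolP/= Axy.
apply/imsetP; exists ((a i)^-1 x', (b i)^-1 y')%g; last by rewrite /= !permKV.
apply/orP; have [Pxy|nP] := boolP (P i ((a i)^-1%g x') ((b i)^-1%g y')).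
  by right; rewrite unfold_in.
by left; apply/asboolP; apply: AB nP; rewrite !permKV.
Qed.

Lemma mass_scarce A (P : forall i, X i -> Y i -> bool) :
  bounded_clopen A -> scarce R P ->
  (forall i x y, A (code x y) -> P i x y) -> mass A = 0.
Proof.
move=> bA sP AP; apply/eqP; rewrite eq_le mass_ge0 andbT.
have -> : 0 = mass set0.
  have := massU bounded_clopen0 bounded_clopen0 (setI0 _).
  by rewrite setU0 => /(congr1 (fun x => x - mass set0)); rewrite addrK subrr.
apply: (@le_mass _ _ P (fun=> 1%g) (fun=> 1%g)) => //.
  exact: bounded_clopen0.
by move=> i x y; rewrite !perm1 => /AP ->.
Qed.

End limit_mass.

(** * Translation invariance and null conditions *)

Lemma scarceW (R : realType) (X Y : nat -> finType)
    (P Q : forall i, X i -> Y i -> bool) :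
  (forall i x y, P i x y -> Q i x y) -> scarce R Q -> scarce R P.
Proof.
move=> PQ sQ e /sQ[N HN]; exists N => i /HN; apply: le_trans; rewrite ler_nat.
by apply: subset_leq_card; apply/fintype.subsetP => p; rewrite !unfold_in; exact: PQ.
Qed.

Section local_relations.
Context (R : realType) (G L : groupType) (X Y : nat -> finType)
    (sigma : forall i, G -> {perm X i}) (tau : forall i, L -> {perm Y i})
    (f : forall i, X i -> Y i) (g : forall i, Y i -> X i).
Hypothesis fc : finite_coupling R sigma tau f g.
Notation index := (G * L * bool)%type.

(** Both kinds of conditions are graphs, of f or of g with the roles exchanged. *)
Lemma scarce_code (p : index) (a : forall i, {perm X i}) (b : forall i, {perm Y i})
    (P : forall i, pred (X i)) (Q : forall i, pred (Y i)) :
  small R P -> small R Q ->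
  scarce R (fun i x y => code sigma tau f g (a i x) (b i y) p && (P i x || Q i y)).
Proof.
move=> sP sQ; case: p => -[c d] []; rewrite /code/=; last first.
  have := scarce_graph fc (fun i => (a i * sigma i c)%g) (fun i => (b i * tau i d)%g) sP sQ.
  by apply: scarceW => i x y; rewrite !permM.
apply: (scarce_sym fc).
have := scarce_graph (finite_coupling_sym fc) (fun i => (b i * tau i d)%g)
  (fun i => (a i * sigma i c)%g) sQ sP.
by apply: scarceW => i y x; rewrite !permM [P _ _ || _]orbC.
Qed.

(** Goodness is also asked of the translates c x and d y, which are the points that
    a condition on the pair at (c, d) compares through f or g. *)
Definition good_pair (F : seq G) (F' : seq L) (c : G) (d : L) i (x : X i) (y : Y i) :=
  [&& good (sigma i) F x, good (sigma i) F (sigma i c x),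
      good (tau i) F' y & good (tau i) F' (tau i d y)].

Lemma scarce_bad (p : index) (F : seq G) (F' : seq L) :
  scarce R (fun i (x : X i) (y : Y i) => code sigma tau f g x y p && ~~ good_pair F F' p.1.1 p.1.2 x y).
Proof.
have sX : small R (fun i => [pred x | ~~ good (sigma i) F x || ~~ good (sigma i) F (sigma i p.1.1 x)]).
  apply: smallU; first exact: (fc_free fc).
  exact: (small_perm (fun i => sigma i p.1.1) (fc_free fc F)).
have sY : small R (fun i => [pred y | ~~ good (tau i) F' y || ~~ good (tau i) F' (tau i p.1.2 y)]).
  apply: smallU; first exact: (fc_free' fc).
  exact: (small_perm (fun i => tau i p.1.2) (fc_free' fc F')).
have := scarce_code p (fun=> 1%g) (fun=> 1%g) sX sY.
apply: scarceW => i x y /andP[cp]; rewrite !perm1 cp/= /good_pair !negb_and.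
by rewrite -!orbA.
Qed.

(** If f maps c x to d y then it maps h c x near d y, by coarse control at c x; the set
    B depends on h only, while the goodness required depends on c and d. *)
Lemma graph_step (h : G) : exists B : seq L, forall c d, exists F F',
  forall i (x : X i) (y : Y i), good_pair F F' c d x y ->
    f (sigma i c x) = tau i d y ->
    exists2 b, b \in B & f (sigma i (h * c)%g x) = tau i (b * d)%g y.
Proof.
have [F [F' [B HB]]] := fc_ctrl fc h; exists B => c d.
exists ([:: h; c] ++ F), (B ++ d :: F') => i x y /and4P[gx gcx gy gdy] e.
have sF : {subset F <= [:: h; c] ++ F} by move=> z zF; rewrite mem_cat zF orbT.
have sF' : {subset F' <= B ++ d :: F'} by move=> z zF; rewrite mem_cat inE zF !orbT.
have := HB i (sigma i c x) (good_sub sF gcx).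
rewrite e => /(_ (good_sub sF' gdy)) [b bB e']; exists b => //.
have bF : b \in B ++ d :: F' by rewrite mem_cat bB.
have dF : d \in B ++ d :: F' by rewrite mem_cat mem_head orbT.
by rewrite -(good_mul gx) ?inE ?eqxx ?orbT// e' (good_mul gy).
Qed.

Lemma graph_inverse : exists B : seq G, forall c d, exists F F',
  forall i (x : X i) (y : Y i), good_pair F F' c d x y ->
    f (sigma i c x) = tau i d y ->
    exists2 b, b \in B & g (tau i d y) = sigma i (b * c)%g x.
Proof.
have [F [B HB]] := fc_inv fc; exists B => c d.
exists (B ++ c :: F), [::] => i x y /and4P[gx gcx _ _] e.
have sF : {subset F <= B ++ c :: F} by move=> z zF; rewrite mem_cat inE zF !orbT.
have [b bB e'] := HB i (sigma i c x) (good_sub sF gcx); exists b => //.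
rewrite -e e' (good_mul gx)//; first by rewrite mem_cat bB.
by rewrite mem_cat mem_head orbT.
Qed.

(** At a good point y the translates d y and d' y differ. *)
Lemma graph_functional (d d' : L) : d <> d' -> forall c, exists F F',
  forall i (x : X i) (y : Y i), good_pair F F' c d x y ->
    f (sigma i c x) = tau i d y -> f (sigma i c x) <> tau i d' y.
Proof.
move=> dd' c; exists [::], [:: 1; d; d'; d'^-1; d'^-1 * d]%g => i x y.
by move=> /and4P[_ _ gy _] -> e; apply: dd'; exact: (good_inj gy) e.
Qed.

End local_relations.

Section shifts.
Context {G L : groupType}.
Notation index := (G * L * bool)%type.

(** The action matching x |-> h x: the point recorded for (h x, y) has at (s, t) the
    value recorded for (x, y) at (s h, t). *)
Definition shift_left (h : G) (w : cube index) : cube index :=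
  fun p => w (p.1.1 * h, p.1.2, p.2)%g.

(** The right action matching y |-> k^-1 y. *)
Definition shift_right (w : cube index) (k : L) : cube index :=
  fun p => w (p.1.1, p.1.2 * k^-1, p.2)%g.

Lemma shift_left_containing h s : shift_left h @^-1` containing s =
  containing [seq (p.1.1 * h, p.1.2, p.2)%g | p <- s].
Proof. by apply/seteqP; split=> w; rewrite /= /containing/= all_map. Qed.

Lemma shift_right_containing k s : (fun w => shift_right w k) @^-1` containing s =
  containing [seq (p.1.1, p.1.2 * k^-1, p.2)%g | p <- s].
Proof. by apply/seteqP; split=> w; rewrite /= /containing/= all_map. Qed.

End shifts.

Section mass_facts.
Context (R : realType) (G L : groupType) (X Y : nat -> finType)
    (sigma : forall i, G -> {perm X i}) (tau : forall i, L -> {perm Y i})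
    (f : forall i, X i -> Y i) (g : forall i, Y i -> X i).
Hypothesis fc : finite_coupling R sigma tau f g.
Context (U : set_system nat) (UU : UltraFilter U) (Uoo : \oo `<=` U).
Notation index := (G * L * bool)%type.
Notation mass := (mass R sigma tau f g U).

(** The pairs satisfying the condition p without being good are scarce. *)
Lemma mass_null A (p : index) F F' :
  bounded_clopen A -> (forall w, A w -> w p) ->
  (forall i (x : X i) (y : Y i), good_pair sigma tau F F' p.1.1 p.1.2 x y ->
     ~ A (code sigma tau f g x y)) ->
  mass A = 0.
Proof.
move=> bA Ap gA; apply: (mass_scarce fc UU Uoo bA (scarce_bad fc p F F')).
by move=> i x y Axy; rewrite (Ap _ Axy)/=; apply/negP => /gA.
Qed.

(** The translated condition differs from the condition for the translated pair only
    at points where sigma fails to be multiplicative on the finitely many elements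
    that occur in s. *)
Lemma mass_shift_left_le h s : s != [::] ->
  mass (containing s) <=
  mass (containing [seq (p.1.1 * h, p.1.2, p.2)%g | p <- s]).
Proof.
move=> s0; have [p ps] : exists p, p \in s.
  by case: s s0 => // p s _; exists p; exact: mem_head.
pose F := h :: [seq q.1.1 | q <- s].
have sP := scarce_code fc p (fun i => sigma i h) (fun=> 1%g) (fc_free fc F) (fc_free' fc [::]).
apply: (le_mass fc UU Uoo _ _ sP (a := fun i => sigma i h) (b := fun=> 1%g)).
- exact: bounded_clopen_containing.
- by apply: bounded_clopen_containing; case: (s) s0.
move=> i x y; rewrite perm1 => /allP ts.
rewrite (ts p ps)/= => /norP[/negbNE gx _].
apply/allP => _ /mapP[q qs ->]; move: (ts q qs).
rewrite /code/= -(good_mul gx) ?mem_head//.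
by rewrite inE (map_f (fun q : index => q.1.1) qs) orbT.
Qed.

Lemma mass_shift_right_le k s : s != [::] ->
  mass (containing s) <=
  mass (containing [seq (p.1.1, p.1.2 * k^-1, p.2)%g | p <- s]).
Proof.
move=> s0; have [p ps] : exists p, p \in s.
  by case: s s0 => // p s _; exists p; exact: mem_head.
pose F := (k^-1)%g :: [seq q.1.2 | q <- s].
have sP := scarce_code fc p (fun=> 1%g) (fun i => tau i k^-1%g) (fc_free fc [::]) (fc_free' fc F).
apply: (le_mass fc UU Uoo _ _ sP (a := fun=> 1%g) (b := fun i => tau i k^-1%g)).
- exact: bounded_clopen_containing.
- by apply: bounded_clopen_containing; case: (s) s0.
move=> i x y; rewrite perm1 => /allP ts.
rewrite (ts p ps)/= => /negbNE gy.
apply/allP => _ /mapP[q qs ->]; move: (ts q qs).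
rewrite /code/= -(good_mul gy) ?mem_head//.
by rewrite inE (map_f (fun q : index => q.1.2) qs) orbT.
Qed.

Lemma mass_shift_left h s : s != [::] ->
  mass (shift_left h @^-1` containing s) = mass (containing s).
Proof.
move=> s0; rewrite shift_left_containing; apply/le_anti/andP.
split; last exact: mass_shift_left_le.
apply: le_trans (mass_shift_left_le h^-1%g _) _; first by case: (s) s0.
rewrite -map_comp (_ : map _ _ = s)//.
by rewrite -[RHS]map_id; apply: eq_map => -[[a b] c] /=; rewrite mulgK.
Qed.

Lemma mass_shift_right k s : s != [::] ->
  mass ((fun w => shift_right w k) @^-1` containing s) = mass (containing s).
Proof.
move=> s0; rewrite shift_right_containing; apply/le_anti/andP.
split; last exact: mass_shift_right_le.
apply: le_trans (mass_shift_right_le k^-1%g _) _; first by case: (s) s0.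
rewrite -map_comp (_ : map _ _ = s)//.
by rewrite -[RHS]map_id; apply: eq_map => -[[a b] c] /=; rewrite invgK mulgVK.
Qed.

End mass_facts.

(** * The limit measure and its generic points *)

Section reindexing.
Context (R : realType) (I : choiceType) (cI : countable [set: I]).
Context (rho : {measure set (borel_type (cube I)) -> \bar R}).

Definition reindex (phi : I -> I) (w : borel_type (cube I)) : borel_type (cube I) :=
  fun i => w (phi i).

Lemma measurable_reindex phi : measurable_fun setT (reindex phi).
Proof.
apply: (@measurability _ _ _ (borel_type (cube I)) setT _ (@open (cube I)) erefl).
move=> _ [A oA <-]; rewrite setTI.
apply: (@open_sigma_algebra I [set B | measurable (reindex phi @^-1` B)]) oA => //.
- split=> [|B mB|F mF] /=; first by rewrite preimage_set0.
    by rewrite setTD preimage_setC; exact: measurableC.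
  by rewrite preimage_bigcup; exact: bigcupT_measurable.
- move=> i /=; rewrite (_ : _ @^-1` _ = containing [:: phi i]).
    by apply: bounded_clopen_measurable; exact: bounded_clopen_containing.
  by apply/seteqP; split=> w.
Qed.

(** The image measure and rho agree on the sets [containing s]; surjectivity of phi
    makes the zero point the only point sent to zero. *)
Lemma reindex_measure_preserving (phi psi : I -> I) : cancel psi phi ->
  rho [set (fun=> false)] = 0%E ->
  (forall i, (rho (containing [:: i]) < +oo)%E) ->
  (forall s, s != [::] ->
     rho (reindex phi @^-1` containing s) = rho (containing s)) ->
  measure_preserving rho (reindex phi).
Proof.
move=> psiK rho0 fin inv; split; first exact: measurable_reindex.
move=> A mA.
apply: (@cube_measure_unique R I (pushforward rho (reindex phi)) rho) => //.
- exact: measurable_reindex.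
- move=> mf; rewrite -[RHS]rho0 /pushforward; congr (rho _); apply/seteqP; split=> w.
    by move=> w0; apply/funext => i; have := congr1 (fun v => v (psi i)) w0; rewrite /reindex psiK.
  by move=> ->.
- by move=> mf i; have := fin i; rewrite -(inv [:: i] isT).
Qed.

End reindexing.

Lemma negligible_countable_bigcup d (T : sigmaRingType d) (R : realFieldType)
    (mu : {measure set T -> \bar R}) (I : Type) (F : I -> set T) :
  countable [set: I] -> (forall i, mu.-negligible (F i)) ->
  mu.-negligible (\bigcup_i F i).
Proof.
move=> /countable_enum[e eI] F0.
apply: (@negligibleS _ _ _ mu (\bigcup_n oapp F set0 (e n))).
  by move=> w [i _ Fw]; have [n en] := eI i; exists n => //; rewrite en.
by apply: negligible_bigcup => n; case: (e n) => [i|] //=; exact: negligible_set0.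
Qed.

Section generic.
Context {G L : groupType}.
Notation index := (G * L * bool)%type.

(** The relation at level false is the graph of a function phi : G -> L, and the one at
    level true is, transposed, the graph of psi : L -> G. In these terms the fields
    say that phi (h a) is in (Bf h) phi a, psi (k b) is in (Bg k) psi b, psi (phi a)
    is in B1 a and phi (psi b) is in B2 b. *)
Record generic (Bf : G -> seq L) (Bg : L -> seq G) (B1 : seq G) (B2 : seq L)
    (w : cube index) : Prop := Generic {
  gen_nonzero : exists p, w p;
  gen_fun : forall a b b', w (a, b, false) -> w (a, b', false) -> b = b';
  gen_fun' : forall b a a', w (a, b, true) -> w (a', b, true) -> a = a';
  gen_step : forall h a b, w (a, b, false) ->
    exists2 c, c \in Bf h & w (h * a, c * b, false)%g;
  gen_step' : forall k a b, w (a, b, true) ->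
    exists2 c, c \in Bg k & w (c * a, k * b, true)%g;
  gen_inv : forall a b, w (a, b, false) ->
    exists2 c, c \in B1 & w (c * a, b, true)%g;
  gen_inv' : forall a b, w (a, b, true) ->
    exists2 c, c \in B2 & w (a, c * b, false)%g }.

End generic.

Section limit_measure.
Context (R : realType) (G L : groupType) (X Y : nat -> finType)
    (sigma : forall i, G -> {perm X i}) (tau : forall i, L -> {perm Y i})
    (f : forall i, X i -> Y i) (g : forall i, Y i -> X i).
Hypothesis fc : finite_coupling R sigma tau f g.
Hypotheses (cG : countable [set: G]) (cL : countable [set: L]).
Notation index := (G * L * bool)%type.

Lemma countable_index : countable [set: index].
Proof.
have [f1 i1] := countable_injP _ cG; have [f2 i2] := countable_injP _ cL.
apply/countable_injP.
exists (fun p : index => choice.pickle (f1 p.1.1, f2 p.1.2, p.2)).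
move=> [[a b] c] [[a' b'] c'] _ _ /(pcan_inj choice.pickleK)[e1 e2 ->].
by rewrite (i1 _ _ _ _ e1) ?inE// (i2 _ _ _ _ e2) ?inE.
Qed.

Lemma good_pair_swap F F' c d i (x : X i) (y : Y i) :
  good_pair tau sigma F' F d c y x = good_pair sigma tau F F' c d x y.
Proof. by rewrite /good_pair -!andbA; do !bool_congr. Qed.

(** Apart from the zero point, which is null, each clause in the definition of a
    generic point fails only on a countable union of bounded clopen sets, indexed by
    elements of the groups, and each of these is null since no good pair is coded
    in it. *)
Lemma limit_measure :
  exists (rho : {measure set (borel_type (cube index)) -> \bar R})
    (Bf : G -> seq L) (Bg : L -> seq G) (B1 : seq G) (B2 : seq L),
  [/\ rho (containing [:: (1, 1, false)]%g) = 1%E,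
      forall p, (rho (containing [:: p]) < +oo)%E,
      rho.-negligible (~` generic Bf Bg B1 B2),
      forall h, measure_preserving rho (shift_left h)
    & forall k, measure_preserving rho (fun w => shift_right w k)].
Proof.
have [U [UU Uoo]] := @ultraFilterLemma nat \oo _.
have cI := countable_index.
have [rho [rhoE rho0]] := cube_measure_exists (mass_ge0 R sigma tau f g U)
  (massU fc UU) cI.
have fin p : (rho (containing [:: p]) < +oo)%E.
  by rewrite rhoE ?ltry//; exact: bounded_clopen_containing.
have [Bf HBf] := choice (graph_step fc).
have [Bg HBg] := choice (graph_step (finite_coupling_sym fc)).
have [B1 HB1] := graph_inverse fc.
have [B2 HB2] := graph_inverse (finite_coupling_sym fc).
exists rho, Bf, Bg, B1, B2.
have null (A : set (cube index)) (p : index) F F' :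
  bounded_clopen A -> (forall w, A w -> w p) ->
  (forall i (x : X i) (y : Y i), good_pair sigma tau F F' p.1.1 p.1.2 x y ->
     ~ A (code sigma tau f g x y)) -> rho.-negligible A.
  move=> bA Ap gA; apply/negligibleP; first exact: bounded_clopen_measurable.
  by have := rhoE _ bA; rewrite (mass_null fc UU Uoo bA Ap gA).
have both (p q : index) : bounded_clopen [set w : cube index | w p /\ w q].
  rewrite (_ : mkset _ = containing [:: p; q]).
    exact: bounded_clopen_containing.
  by apply/seteqP; split=> w; rewrite /containing/= andbT => /andP.
have miss (p : index) (s : seq index) :
    bounded_clopen [set w : cube index | w p /\ ~ has (fun q => w q) s].
  rewrite (_ : mkset _ = containing [:: p] `\` touching s).
    apply: bounded_clopenD; first exact: bounded_clopen_containing.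
    by split; [exact: clopen_touching|exists s].
  by apply/seteqP; split=> w; rewrite /containing/= andbT.
(* N1 to N6: each clause of [generic] after [gen_nonzero], in order, fails only on a
   null set. *)
have N1 a b b' : rho.-negligible
    [set w : cube index | b <> b' /\ (w (a, b, false) /\ w (a, b', false))].
  have [->|/eqP bb'] := eqVneq b b'.
    by apply: negligibleS (negligible_set0 rho) => w [].
  apply: negligibleS => [w [_ wp]|]; first exact: wp.
  have [F [F' H]] := graph_functional sigma tau f bb' a.
  apply: (null _ (a, b, false) F F'); [exact: (both (a, b, _) (_, _, _))|by move=> w []|].
  by move=> i x y gp [/eqP/(H _ _ _ gp) ne /eqP].
have N2 b a a' : rho.-negligible
    [set w : cube index | a <> a' /\ (w (a, b, true) /\ w (a', b, true))].
  have [->|/eqP aa'] := eqVneq a a'.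
    by apply: negligibleS (negligible_set0 rho) => w [].
  apply: negligibleS => [w [_ wp]|]; first exact: wp.
  have [F' [F H]] := graph_functional tau sigma g aa' b.
  apply: (null _ (a, b, true) F F'); [exact: (both (a, b, _) (_, _, _))|by move=> w []|].
  by move=> i x y; rewrite -good_pair_swap => gp [/eqP/(H _ _ _ gp) ne /eqP].
have N3 h a b : rho.-negligible [set w : cube index | w (a, b, false) /\
    ~ has (fun q => w q) [seq (h * a, c * b, false)%g | c <- Bf h]].
  have [F [F' H]] := HBf h a b.
  apply: (null _ (a, b, false) F F'); [exact: (miss (a, b, _))|by move=> w []|].
  move=> i x y gp [/eqP/(H _ _ _ gp)[c cB e]]; apply.
  by rewrite has_map; apply/hasP; exists c => //; apply/eqP.
have N4 k a b : rho.-negligible [set w : cube index | w (a, b, true) /\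
    ~ has (fun q => w q) [seq (c * a, k * b, true)%g | c <- Bg k]].
  have [F' [F H]] := HBg k b a.
  apply: (null _ (a, b, true) F F'); [exact: (miss (a, b, _))|by move=> w []|].
  move=> i x y; rewrite -good_pair_swap => gp [/eqP/(H _ _ _ gp)[c cB e]]; apply.
  by rewrite has_map; apply/hasP; exists c => //; apply/eqP.
have N5 a b : rho.-negligible [set w : cube index | w (a, b, false) /\
    ~ has (fun q => w q) [seq (c * a, b, true)%g | c <- B1]].
  have [F [F' H]] := HB1 a b.
  apply: (null _ (a, b, false) F F'); [exact: (miss (a, b, _))|by move=> w []|].
  move=> i x y gp [/eqP/(H _ _ _ gp)[c cB e]]; apply.
  by rewrite has_map; apply/hasP; exists c => //; apply/eqP.
have N6 a b : rho.-negligible [set w : cube index | w (a, b, true) /\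
    ~ has (fun q => w q) [seq (a, c * b, false)%g | c <- B2]].
  have [F' [F H]] := HB2 b a.
  apply: (null _ (a, b, true) F F'); [exact: (miss (a, b, _))|by move=> w []|].
  move=> i x y; rewrite -good_pair_swap => gp [/eqP/(H _ _ _ gp)[c cB e]]; apply.
  by rewrite has_map; apply/hasP; exists c => //; apply/eqP.
have bG F := @negligible_countable_bigcup _ _ R rho G F cG.
have bL F := @negligible_countable_bigcup _ _ R rho L F cL.
have N0 : rho.-negligible [set (fun=> false)].
  by apply/negligibleP => //; exact: measurable_cube_zero.
split=> //.
- rewrite rhoE ?(mass_graph fc UU)//; exact: bounded_clopen_containing.
- apply: (negligibleS _ (negligibleU (negligibleU (negligibleU (negligibleU (negligibleU
      (bG _ (fun a => bL _ (fun b => bL _ (N1 a b)))) (bL _ (fun b => bG _ (fun a => bG _ (N2 b a)))))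
      (bG _ (fun h => bG _ (fun a => bL _ (N3 h a))))) (bL _ (fun k => bG _ (fun a => bL _ (N4 k a)))))
      (bG _ (fun a => bL _ (N5 a)))) (negligibleU (bG _ (fun a => bL _ (N6 a)))
      N0))).
  move=> w ngen; apply: contrapT => nZ; apply: ngen; split.
  + apply: contrapT => w0; apply: nZ; right; right; apply/funext => p.
    by apply/negbTE/negP => wp; apply: w0; exists p.
  + move=> a b b' wb wb'; apply: contrapT => bb'; apply: nZ.
    by left; left; left; left; left; exists a => //; exists b => //; exists b'.
  + move=> b a a' wa wa'; apply: contrapT => aa'; apply: nZ.
    by left; left; left; left; right; exists b => //; exists a => //; exists a'.
  + move=> h a b wab; apply: contrapT => nc; apply: nZ.
    left; left; left; right; exists h => //; exists a => //; exists b => //; split=> //.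
    by rewrite has_map => /hasP[c cB wc]; apply: nc; exists c.
  + move=> k a b wab; apply: contrapT => nc; apply: nZ.
    left; left; right; exists k => //; exists a => //; exists b => //; split=> //.
    by rewrite has_map => /hasP[c cB wc]; apply: nc; exists c.
  + move=> a b wab; apply: contrapT => nc; apply: nZ.
    left; right; exists a => //; exists b => //; split=> //.
    by rewrite has_map => /hasP[c cB wc]; apply: nc; exists c.
  + move=> a b wab; apply: contrapT => nc; apply: nZ.
    right; left; exists a => //; exists b => //; split=> //.
    by rewrite has_map => /hasP[c cB wc]; apply: nc; exists c.
- move=> h; apply: (reindex_measure_preserving cI
    (phi := fun p => (p.1.1 * h, p.1.2, p.2)%g)
    (psi := fun p => (p.1.1 * h^-1, p.1.2, p.2)%g)) => //.
    by move=> [[a b] c] /=; rewrite mulgVK.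
  move=> s s0; rewrite !rhoE; first by congr _%:E; exact: (mass_shift_left fc UU Uoo).
    exact: bounded_clopen_containing.
  rewrite -[X in bounded_clopen X]/(shift_left h @^-1` containing s).
  by rewrite shift_left_containing; apply: bounded_clopen_containing; case: (s) s0.
- move=> k; apply: (reindex_measure_preserving cI
    (phi := fun p => (p.1.1, p.1.2 * k^-1, p.2)%g)
    (psi := fun p => (p.1.1, p.1.2 * k, p.2)%g)) => //.
    by move=> [[a b] c] /=; rewrite mulgK.
  move=> s s0; rewrite !rhoE; first by congr _%:E; exact: (mass_shift_right fc UU Uoo).
    exact: bounded_clopen_containing.
  rewrite -[X in bounded_clopen X]/((fun w => shift_right w k) @^-1` containing s).
  by rewrite shift_right_containing; apply: bounded_clopen_containing; case: (s) s0.
Qed.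
End limit_measure.

(** * Word lengths and quasi-isometries *)

Lemma leastP (A : set nat) n : A n -> A (least A) /\ (least A <= n)%N.
Proof.
move=> An; rewrite /least.
have [k [Ak kmin]] : exists k, A k /\ forall m, A m -> (k <= m)%N.
  have ex : exists k, `[< A k >] by exists n; apply/asboolP.
  have [k /asboolP Ak kmin] := ex_minnP ex; exists k; split=> // m Am.
  by apply: kmin; apply/asboolP.
case: xgetP => [m _ [Am mmin]|/(_ k)[]//]; first by split=> //; exact: mmin.
Qed.

Section word_length.
Context {G : groupType} (S : seq G).

Lemma words_cat g h w v : words S g w -> words S h v -> words S (g * h)%g (w ++ v).
Proof. by move=> [aw <-] [av <-]; split; rewrite ?all_cat ?aw// big_cat. Qed.

Lemma words_inv g w : words S g w -> words S g^-1%g (rev [seq x^-1%g | x <- w]).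
Proof.
move=> [aw <-]; split.
  rewrite all_rev all_map; apply: sub_all aw => x /=.
  by rewrite invgK orbC.
elim: w {aw} => [|x w IH]; first by rewrite !big_nil invg1.
by rewrite /= rev_cons -cats1 big_cat IH big_seq1 big_cons invMg.
Qed.

Lemma word_length_le g w : words S g w -> (word_length S g <= size w)%N.
Proof. by move=> gw; apply: (leastP _).2; exists w. Qed.

Hypothesis genS : generates S.

Lemma word_lengthP g : exists2 w, words S g w & size w = word_length S g.
Proof.
have [w gw] := genS g.
have gS : [set size v | v in words S g] (size w) by exists w.
by have [[v gv vS] _] := leastP gS; exists v.
Qed.

Lemma word_lengthM g h : (word_length S (g * h)%g <= word_length S g + word_length S h)%N.
Proof.
have [w gw <-] := word_lengthP g; have [v hv <-] := word_lengthP h.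
by rewrite -size_cat; apply: word_length_le; exact: words_cat.
Qed.

Lemma word_lengthV g : (word_length S g^-1%g <= word_length S g)%N.
Proof.
have [w gw <-] := word_lengthP g.
by apply: leq_trans (word_length_le (words_inv gw)) _; rewrite size_rev size_map.
Qed.

End word_length.

Lemma seq_bounded (T : eqType) (F : T -> nat) (s : seq T) :
  exists M, forall x, x \in s -> (F x <= M)%N.
Proof.
elim: s => [|y s [M HM]]; first by exists 0%N.
exists (maxn (F y) M) => x; rewrite inE => /predU1P[->|/HM]; first exact: leq_maxl.
by move=> FM; rewrite leq_max FM orbT.
Qed.

(** The finitely many generators and their inverses have a common bound, and the
    displacement along a word is the product of the displacements along its
    letters. *)
Lemma controlled_lipschitz (G L : groupType) (S : seq G) (T : seq L) (phi : G -> L) :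
  generates S -> generates T ->
  (forall h, exists B : seq L, forall a, phi (h * a)%g * (phi a)^-1 \in B)%g ->
  exists A, forall h a,
    (word_length T (phi (h * a) * (phi a)^-1)%g <= A * word_length S h)%N.
Proof.
move=> genS genT ctrl.
have [A HA] : exists A, forall x, (x \in S) || (x^-1%g \in S) ->
    forall a, (word_length T (phi (x * a) * (phi a)^-1)%g <= A)%N.
  have [Ax HAx] := choice (fun x => let: ex_intro B HB := ctrl x in
    let: ex_intro M HM := seq_bounded (word_length T) B in
    ex_intro (fun M => forall a, (word_length T (phi (x * a) * (phi a)^-1)%g <= M)%N)
      M (fun a => HM _ (HB a))).
  have [A HA] := seq_bounded Ax (S ++ [seq x^-1%g | x <- S]).
  exists A => x xS a; apply: leq_trans (HAx x a) _; apply: HA.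
  rewrite mem_cat; case/orP: xS => [->//|xS].
  by apply/orP; right; rewrite -[x]invgK map_f.
exists A => h a; have [w [aw <-] <-] := word_lengthP genS h.
elim: w aw => [|x w IH] /=.
  rewrite big_nil mul1g mulgV => _; rewrite muln0.
  by have := @word_length_le L T 1%g [::]; apply; split=> //; rewrite big_nil.
move=> /andP[xS /IH {}IH]; rewrite big_cons mulnS.
set p := (\prod_(y <- w) y)%g in IH *.
have -> : (phi (x * p * a) * (phi a)^-1 =
  (phi (x * (p * a)) * (phi (p * a))^-1) * (phi (p * a) * (phi a)^-1))%g.
  by rewrite !mulgA mulgVK.
by apply: leq_trans (word_lengthM genT _ _) _; apply: leq_add => //; exact: HA.
Qed.

Section quasi_isometry.
Context (R : realType) (G L : groupType) (S : seq G) (T : seq L)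
  (genS : generates S) (genT : generates T).

(** The hypotheses bound displacements on the left, that is for the right-invariant
    word metrics; conjugating phi with inversion turns them into bounds for the
    left-invariant ones. *)
Lemma quasi_isometric_of_controlled (phi : G -> L) (psi : L -> G) :
  (forall h, exists B : seq L, forall a, phi (h * a)%g * (phi a)^-1 \in B)%g ->
  (forall k, exists B : seq G, forall b, psi (k * b)%g * (psi b)^-1 \in B)%g ->
  (exists B : seq G, forall a, psi (phi a) * a^-1 \in B)%g ->
  (exists B : seq L, forall b, phi (psi b) * b^-1 \in B)%g ->
  quasi_isometric (word_metric R S) (word_metric R T).
Proof.
move=> cphi cpsi [B1 HB1] [B2 HB2].
have [A1 HA1] := controlled_lipschitz genS genT cphi.
have [A2 HA2] := controlled_lipschitz genT genS cpsi.
have [M1 HM1] := seq_bounded (word_length S) B1.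
have [M2 HM2] := seq_bounded (word_length T) B2.
pose A := (A1 + A2).+1; pose B := (M1 + M1 + M2)%N.
have A0 : 0 < A%:R :> R by [].
exists (fun x => (phi x^-1)^-1)%g, A%:R, B%:R; split.
- by rewrite ler1n.
- by [].
- move=> x y; rewrite /word_metric invgK.
  have up : (word_length T (phi x^-1 * (phi y^-1)^-1)%g <= A1 * word_length S (x^-1 * y)%g)%N.
    by have := HA1 (x^-1 * y)%g y^-1%g; rewrite mulgK.
  have lo : (word_length S (x^-1 * y)%g <=
      A2 * word_length T (phi x^-1 * (phi y^-1)^-1)%g + (M1 + M1))%N.
    set d := (phi x^-1 * (phi y^-1)^-1)%g.
    have := HA2 d (phi y^-1%g); rewrite mulgVK => H2.
    have -> : (x^-1 * y = (psi (phi x^-1) * x^-1^-1)^-1 *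
       ((psi (phi x^-1) * (psi (phi y^-1))^-1) * (psi (phi y^-1) * y^-1^-1)))%g.
      by rewrite !invMg !invgK !mulgA mulgVK mulgVK.
    apply: leq_trans (word_lengthM genS _ _) _; rewrite addnCA.
    apply: leq_add; first by apply: leq_trans (word_lengthV genS _) _; exact: HM1.
    apply: leq_trans (word_lengthM genS _ _) _.
    by apply: leq_add => //; exact: HM1.
  split; last first.
    rewrite -natrM -natrD ler_nat; apply: leq_trans up _.
    apply: leq_trans (leq_addr _ _); rewrite leq_mul2r; apply/orP; right.
    by rewrite /A ltnW// ltnS leq_addr.
  rewrite lerBlDr mulrC ler_pdivrMr// -natrD -natrM ler_nat.
  apply: leq_trans lo _; rewrite mulnDl leq_add//.
    by rewrite mulnC leq_mul2l; apply/orP; right; rewrite /A ltnW// ltnS leq_addl.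
  by apply: leq_trans (leq_pmulr _ _) => //; exact: leq_addr.
- move=> u; exists ((psi u^-1)^-1)%g; rewrite /word_metric !invgK ler_nat.
  by apply: leq_trans (HM2 _ _) _; [have := HB2 u^-1%g; rewrite invgK|rewrite leq_addl].
Qed.
End quasi_isometry.

(** * Balls in sofic approximations *)

Section graph_balls.
Context {G : groupType} (S : seq G) {V : finType} (sigma : G -> {perm V}).

Definition neighbours (x : V) : seq V :=
  flatten [seq [:: sigma s x; (sigma s)^-1%g x] | s <- S].

(** An explicit enumeration of the ball with repetitions, of size bounded in terms of
    n and S only. *)
Fixpoint ball_seq n (x : V) : seq V :=
  if n is n'.+1 then x :: flatten [seq ball_seq n' y | y <- neighbours x]
  else [:: x].

Lemma labelled_edge_neighbours x y : labelled_edge S sigma x y -> y \in neighbours x.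
Proof.
move=> /hasP[s sS /orP e]; apply/flattenP; exists [:: sigma s x; (sigma s)^-1%g x].
  exact: (map_f (fun s => [:: sigma s x; (sigma s)^-1%g x])).
by case: e => /eqP <-; rewrite !inE ?permK eqxx ?orbT.
Qed.

Lemma path_ball_seq n x p : path (labelled_edge S sigma) x p -> (size p <= n)%N ->
  last x p \in ball_seq n x.
Proof.
elim: n x p => [|n IH] x [|y p] //=; first by rewrite !inE eqxx.
  by rewrite inE eqxx.
move=> /andP[xy yp] pn; rewrite inE; apply/orP; right.
apply/flattenP; exists (ball_seq n y); last exact: IH.
by apply: map_f; exact: labelled_edge_neighbours.
Qed.

Lemma size_flatten_le (T : Type) N (s : seq (seq T)) :
  all (fun u => (size u <= N)%N) s -> (size (flatten s) <= size s * N)%N.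
Proof.
elim: s => //= u s IH /andP[uN /IH {}IH].
by rewrite size_cat mulSn leq_add.
Qed.

Lemma size_ball_seq n x : (size (ball_seq n x) <= (size S * 2).+1 ^ n)%N.
Proof.
elim: n x => //= n IH x.
have nb : (size (neighbours x) <= size S * 2)%N.
  have := @size_flatten_le _ 2 [seq [:: sigma s x; (sigma s)^-1%g x] | s <- S].
  by rewrite size_map; apply; rewrite all_map; apply/allP.
have := @size_flatten_le _ ((size S * 2).+1 ^ n) [seq ball_seq n y | y <- neighbours x].
rewrite size_map all_map => H; rewrite expnS mulSn -add1n leq_add ?expn_gt0//.
apply: leq_trans (H _) _; first by apply/allP => y _ /=; exact: IH.
by rewrite leq_mul2r nb orbT.
Qed.

End graph_balls.

Section word_balls.
Context {G : groupType} (S : seq G).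

Fixpoint word_ball n : seq G :=
  if n is n'.+1 then
    word_ball n' ++ flatten [seq [:: s * b; s^-1 * b]%g | s <- S, b <- word_ball n']
  else [:: 1%g].

Lemma word_ball_sub m n : (m <= n)%N -> {subset word_ball m <= word_ball n}.
Proof.
move=> /subnK <-; elim: (n - m)%N => // k IH x /IH.
by rewrite addSn /= mem_cat => ->.
Qed.

Lemma word_ballS n s b : s \in S -> b \in word_ball n ->
  (s * b \in word_ball n.+1)%g && (s^-1 * b \in word_ball n.+1)%g.
Proof.
move=> sS bn; rewrite /= !mem_cat.
have H : [:: s * b; s^-1 * b]%g \in [seq [:: s * b; s^-1 * b]%g | s <- S, b <- word_ball n].
  exact: (allpairs_f (fun s b => [:: s * b; s^-1 * b]%g)).
by apply/andP; split; apply/orP; right; apply/flattenP;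
  exists [:: s * b; s^-1 * b]%g; rewrite ?inE ?eqxx ?orbT.
Qed.

(** Along the path every vertex is written sigma b x with b a product of letters.
    Edges may be crossed backwards, and then sigma s^-1 is compared with the inverse
    permutation of sigma s. *)
Lemma path_word_ball (V : finType) (sigma : G -> {perm V}) n x p :
  good sigma (word_ball n ++ S ++ [seq s^-1%g | s <- S]) x ->
  path (labelled_edge S sigma) x p -> (size p <= n)%N ->
  exists2 b, b \in word_ball n & last x p = sigma b x.
Proof.
set F := _ ++ _ => gx.
have Fb b m : (m <= n)%N -> b \in word_ball m -> b \in F.
  by move=> mn /(word_ball_sub mn) bn; rewrite mem_cat bn.
(* The invariant: the current vertex is y = sigma a x with a a product of m letters,
   and q is the rest of the path. *)
have main : forall q m a y, a \in word_ball m -> sigma a x = y ->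
    path (labelled_edge S sigma) y q -> (size q + m <= n)%N ->
    exists2 b, b \in word_ball n & last y q = sigma b x.
  elim=> [|z q IH] m a y am ay /=.
    by move=> _ mn; exists a => //; exact: word_ball_sub am.
  move=> /andP[/hasP[s sS yz] zq] mn.
  have /andP[sa s'a] := word_ballS sS am.
  have mn' : (m < n)%N by apply: leq_trans mn; rewrite addSn ltnS leq_addl.
  have Fs : s \in F by rewrite !mem_cat sS orbT.
  have Fs' : (s^-1)%g \in F by rewrite !mem_cat map_f ?orbT.
  have Fa : a \in F by apply: Fb am; exact: ltnW.
  rewrite addSnnS in mn.
  case/orP: yz => /eqP e.
    by apply: (IH m.+1 (s * a)%g z) => //; rewrite -(good_mul gx)// ay.
  apply: (IH m.+1 (s^-1 * a)%g z) => //.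
  apply: (@perm_inj _ (sigma s)); rewrite e -ay (good_mul gx)//; last exact: Fb s'a.
  by rewrite mulKVg.
move=> xp pn; have one : 1%g \in word_ball 0 by rewrite inE.
apply: (main p 0%N 1%g x) => //; last by rewrite addn0.
by apply: (good_one gx); exact: Fb one.
Qed.

End word_balls.

Section approximation.
Context (R : realType) (G : groupType) (S : seq G) (X : sofic_approximation R S).

Lemma approximation_nonempty i : (0 < #|sa_set X i|)%N.
Proof. by have [] := sa_almost_action X i. Qed.

(** Along indices tending to infinity the finite set F is eventually contained in the
    sets of the approximation, and the proportion of bad points tends to 0. *)
Lemma approximation_almost_free (r : nat -> nat) :
  (forall N, exists M, forall n, (M <= n)%N -> (N <= r n)%N) ->
  almost_free R (fun n => sa_map X (r n)).
Proof.
move=> rinf F e e0.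
have [N1 HN1] : exists N, forall i, (N <= i)%N -> {subset F <= sa_F X i}.
  have mono i j : (i <= j)%N -> {subset sa_F X i <= sa_F X j}.
    move=> /subnK <-; elim: (j - i)%N => // k IH x /IH.
    by rewrite addSn; exact: sa_F_nested.
  elim: F => [|h F [N HN]]; first by exists 0%N.
  have [M hM] := sa_F_union X h; exists (maxn N M) => i.
  rewrite geq_max => /andP[Ni Mi] x; rewrite inE => /predU1P[->|]; last exact: HN.
  exact: mono hM.
have [N2 _ HN2] : \forall i \near \oo, sa_eps X i <= e.
  by apply: (cvgr_le _ (sa_eps_cvg X)).
have [M HM] := rinf (maxn N1 N2); exists M => n /HM; rewrite geq_max.
move=> /andP[/HN1 FF /HN2 /= le_eps].
have [_ [Z [Zcard Zmul Zfree]]] := sa_almost_action X (r n).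
apply: (@le_trans _ _ #|~: Z|%:R).
  rewrite ler_nat; apply: subset_leq_card; apply/fintype.subsetP => x.
  move=> ng; rewrite inE; apply: contra ng => xZ.
  apply/andP; split.
    apply/allP => a aF; apply/allP => b bF; apply/eqP.
    by apply: Zmul => //; exact: FF.
  by apply/allP => a aF; case: eqVneq => //= a1; apply: Zfree => //; exact: FF.
rewrite cardsCs finset.setCK natrB ?max_card//.
move: Zcard; rewrite mulrBl mul1r => Zcard.
apply: (@le_trans _ _ (sa_eps X (r n) * #|sa_set X (r n)|%:R)).
  by rewrite lerBlDr addrC -lerBlDr.
by rewrite ler_wpM2r.
Qed.

Context (d : space_of_graphs X -> space_of_graphs X -> R).
Hypothesis met : graphs_metric d.

Lemma dist_path i (x y : sa_set X i) n : d (in_component x) (in_component y) <= n%:R ->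
  exists p, [/\ path (labelled_edge S (sa_map X i)) x p, last x p = y & (size p <= n)%N].
Proof.
rewrite (graphs_edge met) ler_nat => dn.
have /connectP[p xp py] := sa_connected x y.
have H : [set size q | q in [set q | path (labelled_edge S (sa_map X i)) x q /\ last x q = y]] (size p).
  by exists p.
have [[q [xq qy] qs] _] := leastP H.
by exists q; split=> //; rewrite qs.
Qed.

Lemma dist_edge i (x y : sa_set X i) : labelled_edge S (sa_map X i) x y ->
  d (in_component x) (in_component y) <= 1.
Proof.
move=> xy; rewrite (graphs_edge met) -[leRHS]/(1%:R) ler_nat.
by apply: (leastP _).2; exists [:: y] => //=; rewrite xy.
Qed.

(** A word for h describes a path from x to h x whenever x is good. *)
Lemma dist_translate : generates S -> forall h, exists F : seq G, exists n : nat,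
  forall i (x : sa_set X i), good (sa_map X i) F x ->
    d (in_component x) (in_component (sa_map X i h x)) <= n%:R.
Proof.
move=> genS h; have [w [aw <-]] := genS h.
elim: w aw => [|a w IH] /=.
  move=> _; exists [:: 1%g], 0%N => i x gx; rewrite big_nil (good_one gx) ?inE//.
  by rewrite (metric_eq0 (graphs_is_metric met) _ _).2.
move=> /andP[aS /IH[F [n HF]]]; rewrite big_cons; set p := (\prod_(_ <- w) _)%g in HF *.
exists ([:: a; a^-1; p; a * p]%g ++ F), n.+1 => i x gx.
have gxF : good (sa_map X i) F x.
  by apply: good_sub gx => z zF; rewrite mem_cat zF orbT.
apply: le_trans (metric_triangle (graphs_is_metric met) _ (in_component (sa_map X i p x)) _) _.
rewrite -natr1; apply: lerD; first exact: HF.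
have E b : b \in [:: a; a^-1; p; a * p]%g -> b \in [:: a; a^-1; p; a * p]%g ++ F.
  by rewrite mem_cat => ->.
apply: dist_edge; case/orP: aS => aS; apply/hasP.
  exists a => //; rewrite (good_mul gx) ?eqxx//; apply: E; by rewrite !inE eqxx ?orbT.
exists a^-1%g => //; rewrite [X in _ || X](_ : _ = true) ?orbT//.
rewrite (good_mul gx) ?mulKg ?eqxx//; apply: E; by rewrite !inE eqxx ?orbT.
Qed.

Lemma nat_bound (C : R) : exists n : nat, C <= n%:R.
Proof.
exists (Num.bound `|C|); apply: le_trans (ler_norm _) _.
by apply/ltW/archi_boundP; exact: normr_ge0.
Qed.

(** Closeness in the graph is displacement by a finite set of group elements, at good
    points. *)
Lemma dist_good (C : R) : exists F B : seq G, forall i (x y : sa_set X i),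
  d (in_component x) (in_component y) <= C -> good (sa_map X i) F x ->
  exists2 b, b \in B & y = sa_map X i b x.
Proof.
have [n Cn] := nat_bound C.
exists (word_ball S n ++ S ++ [seq s^-1%g | s <- S]), (word_ball S n) => i x y dC gx.
have [p [xp <- pn]] := dist_path (le_trans dC Cn).
exact: path_word_ball gx xp pn.
Qed.

(** Bounded degree bounds the balls around every point, good or not. *)
Lemma ball_card (C : R) : exists N : nat, forall i (x : sa_set X i) (P : pred (sa_set X i)),
  (forall y, P y -> d (in_component x) (in_component y) <= C) -> (#|P| <= N)%N.
Proof.
have [n Cn] := nat_bound C.
exists ((size S * 2).+1 ^ n)%N => i x P PC.
apply: leq_trans (size_ball_seq S (sa_map X i) n x).
apply: leq_trans (card_size _); apply: subset_leq_card; apply/fintype.subsetP => y Py.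
have [p [xp <- pn]] := dist_path (le_trans (PC y Py) Cn).
exact: path_ball_seq.
Qed.

End approximation.

(** * Coarse equivalences restrict to matched components *)

Section components.
Context (R : realType) (G L : groupType) (S : seq G) (T : seq L)
  (X : sofic_approximation R S) (Y : sofic_approximation R T)
  (dX : space_of_graphs X -> space_of_graphs X -> R)
  (dY : space_of_graphs Y -> space_of_graphs Y -> R)
  (metX : graphs_metric dX) (metY : graphs_metric dY)
  (f : space_of_graphs X -> space_of_graphs Y)
  (g : space_of_graphs Y -> space_of_graphs X).
Hypotheses (bf : bornologous dX dY f) (gf : bounded_distance dX (g \o f) id).

Lemma same_component (C : R) : exists N : nat, forall x x' : space_of_graphs X,
  dX x x' <= C -> (N <= tag x + tag x')%N -> tag x = tag x'.
Proof.
have [N HN] := graphs_separated metX (C + 1); exists N => -[i x] [j x'] /= dC Nij.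
apply/eqP; apply/negPn/negP => ij; have := HN i j ij Nij x x'.
by rewrite leNgt (le_lt_trans dC)// ltrDl.
Qed.

(** The components of index below N are finitely many finite sets, so g sends them
    into finitely many components; a point x with f x there is close to g (f x), hence
    far out it cannot exist. *)
Lemma component_proper N : exists I : nat, forall x : space_of_graphs X,
  (I <= tag x)%N -> (N <= tag (f x))%N.
Proof.
have [C HC] := gf; have [N0 HN0] := same_component C.
have [M HM] : exists M, forall y : space_of_graphs Y, (tag y < N)%N -> (tag (g y) <= M)%N.
  elim: N => [|N [M HM]]; first by exists 0%N.
  have [M' HM'] := seq_bounded (fun y : sa_set Y N => tag (g (in_component y)))
    (enum (sa_set Y N)).
  exists (maxn M M') => -[j y]; rewrite ltnS leq_eqVlt => /predU1P[/= jN|jN].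
    by move: y; rewrite jN => y; rewrite leq_max [X in _ || X](HM' y) ?orbT// mem_enum.
  by rewrite leq_max HM.
exists (maxn N0 M.+1) => x; rewrite geq_max => /andP[N0x Mx].
rewrite leqNgt; apply/negP => /HM; apply/negP; rewrite -ltnNge.
rewrite (HN0 (g (f x)) x)//; first exact: HC.
exact: leq_trans N0x (leq_addl _ _).
Qed.
End components.

Section one_component.
Context (R : realType) (G L : groupType) (S : seq G) (T : seq L)
  (X : sofic_approximation R S) (Y : sofic_approximation R T)
  (dX : space_of_graphs X -> space_of_graphs X -> R)
  (dY : space_of_graphs Y -> space_of_graphs Y -> R)
  (metX : graphs_metric dX) (metY : graphs_metric dY)
  (f : space_of_graphs X -> space_of_graphs Y)
  (g : space_of_graphs Y -> space_of_graphs X).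
Hypotheses (bf : bornologous dX dY f) (gf : bounded_distance dX (g \o f) id).

(** Adjacent vertices have images at bounded distance, which far out forces them into
    the same component; the graphs are connected. *)
Lemma component_constant : exists I : nat, forall i (x x' : sa_set X i),
  (I <= i)%N -> tag (f (in_component x)) = tag (f (in_component x')).
Proof.
have [D HD] := bf 1; have [N HN] := same_component metY D.
have [I HI] := component_proper metX gf N; exists I => i x x' Ii.
have /connectP[p xp ->] := sa_connected x x'.
elim: p x xp => //= y p IH x /andP[xy yp]; rewrite -IH//.
apply: HN; first exact/HD/(dist_edge metX).
by apply: leq_trans (leq_addr _ _); exact: HI.
Qed.

End one_component.

Section matched_components.
Context (R : realType) (G L : groupType) (S : seq G) (T : seq L)
  (X : sofic_approximation R S) (Y : sofic_approximation R T)
  (dX : space_of_graphs X -> space_of_graphs X -> R)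
  (dY : space_of_graphs Y -> space_of_graphs Y -> R)
  (metX : graphs_metric dX) (metY : graphs_metric dY)
  (f : space_of_graphs X -> space_of_graphs Y)
  (g : space_of_graphs Y -> space_of_graphs X).
Hypotheses (bf : bornologous dX dY f) (bg : bornologous dY dX g)
  (gf : bounded_distance dX (g \o f) id) (fg : bounded_distance dY (f \o g) id).

Lemma matched_components : exists r s : nat -> nat,
  [/\ forall N, exists M, forall n, (M <= n)%N -> (N <= r n)%N,
      forall N, exists M, forall n, (M <= n)%N -> (N <= s n)%N,
      forall n (x : sa_set X (r n)), tag (f (in_component x)) = s n
    & forall n (y : sa_set Y (s n)), tag (g (in_component y)) = r n].
Proof.
have [If HIf] := component_constant metX metY bf gf.
have [Ig HIg] := component_constant metY metX bg fg.
have [J HJ] := component_proper metX gf Ig.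
have [C HC] := gf; have [K HK] := same_component metX C.
(* Beyond If the map f respects components, beyond J the image lies where g does,
   and beyond K a point and its image under g o f share their component. *)
pose r n := (n + (If + J + K))%N.
have x0 i : sa_set X i.
  by have /card_gt0P/cid[x _] := approximation_nonempty X i.
pose s n := tag (f (in_component (x0 (r n)))).
have rn n : [/\ If <= r n, J <= r n & K <= r n]%N.
  split; apply: leq_trans (leq_addl _ _); rewrite ?leq_addl//.
    by rewrite -addnA leq_addr.
  by rewrite addnAC leq_addl.
exists r, s; split.
- by move=> N; exists N => n Nn; exact: leq_trans Nn (leq_addr _ _).
- move=> N; have [I' HI'] := component_proper metX gf N; exists I' => n In.
  by apply: HI' => /=; exact: leq_trans In (leq_addr _ _).
- by move=> n x; have [? _ _] := rn n; exact: HIf.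
- move=> n y; have [_ rJ rK] := rn n.
  have fx : in_component (tagged (f (in_component (x0 (r n))))) = f (in_component (x0 (r n))).
    by rewrite /in_component; case: (f _).
  rewrite (HIg _ y (tagged (f (in_component (x0 (r n))))))//; last exact: HJ.
  rewrite fx; apply: (HK (g (f _)) (in_component (x0 (r n)))); first exact: HC.
  exact: leq_trans rK (leq_addl _ _).
Qed.

End matched_components.

Section restricted_maps.
Context (R : realType) (G L : groupType) (S : seq G) (T : seq L)
  (X : sofic_approximation R S) (Y : sofic_approximation R T)
  (dX : space_of_graphs X -> space_of_graphs X -> R)
  (dY : space_of_graphs Y -> space_of_graphs Y -> R)
  (metX : graphs_metric dX) (metY : graphs_metric dY)
  (f : space_of_graphs X -> space_of_graphs Y)
  (g : space_of_graphs Y -> space_of_graphs X)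
  (r s : nat -> nat)
  (fr : forall n, sa_set X (r n) -> sa_set Y (s n))
  (gr : forall n, sa_set Y (s n) -> sa_set X (r n)).
Hypotheses (frE : forall n (x : sa_set X (r n)), f (in_component x) = in_component (@fr n x))
  (grE : forall n (y : sa_set Y (s n)), g (in_component y) = in_component (@gr n y)).

Lemma restriction_controlled : generates S -> bornologous dX dY f ->
  controlled (fun n => sa_map X (r n)) (fun n => sa_map Y (s n)) fr.
Proof.
move=> genS bf h; have [F [n HF]] := dist_translate metX genS h.
have [D HD] := bf n%:R; have [F' [B HB]] := dist_good metY D.
exists F, F', B => i x gx gy; apply: HB gy.
by rewrite -!frE; apply: HD; exact: HF.
Qed.

Lemma restriction_almost_inverse : bounded_distance dX (g \o f) id ->
  almost_inverse (fun n => sa_map X (r n)) fr gr.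
Proof.
move=> [C HC]; have [F [B HB]] := dist_good metX C.
exists F, B => i x gx; apply: HB gx.
by rewrite (metric_symmetric (graphs_is_metric metX)) -grE -frE; exact: HC.
Qed.

Lemma restriction_finite_to_one : bounded_distance dX (g \o f) id ->
  uniformly_finite_to_one fr.
Proof.
move=> [C HC]; have [N HN] := ball_card metX (C + C).
exists N => i y; have [-> //|/card_gt0P[x /eqP xy]] := posnP #|[pred x | fr x == y]|.
apply: (HN _ x) => x' /eqP xy'.
have tri := metric_triangle (graphs_is_metric metX).
apply: le_trans (tri _ (g (f (in_component x))) _) _; apply: lerD.
  by rewrite (metric_symmetric (graphs_is_metric metX)); exact: HC.
by rewrite frE xy -xy' -frE; exact: HC.
Qed.

End restricted_maps.

Lemma finite_coupling_of_coarse_equivalence (R : realType) (G L : groupType)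
    (S : seq G) (T : seq L)
    (X : sofic_approximation R S) (Y : sofic_approximation R T)
    (dX : space_of_graphs X -> space_of_graphs X -> R)
    (dY : space_of_graphs Y -> space_of_graphs Y -> R) :
  generates S -> generates T -> graphs_metric dX -> graphs_metric dY ->
  coarsely_equivalent dX dY ->
  exists r s : nat -> nat, exists fr gr,
    finite_coupling R (fun n => sa_map X (r n)) (fun n => sa_map Y (s n)) fr gr.
Proof.
move=> genS genT metX metY [f [g [bf bg gf fg]]].
have [r [s [rinf sinf tf tg]]] := matched_components metX metY bf bg gf fg.
have lift (H : groupType) (Q : seq H) (Z : sofic_approximation R Q) i
    (z : space_of_graphs Z) : tag z = i -> {z' : sa_set Z i | z = in_component z'}.
  by case: z => j z /= <-; exists z.
pose fr n x := sval (lift _ _ _ _ _ (tf n x)).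
pose gr n y := sval (lift _ _ _ _ _ (tg n y)).
have frE n x : f (in_component x) = in_component (fr n x) 
    by exact: (svalP (lift _ _ _ _ _ (tf n x))).
have grE n y : g (in_component y) = in_component (gr n y) 
    by exact: (svalP (lift _ _ _ _ _ (tg n y))).
exists r, s, fr, gr; split.
- by move=> n; exact: approximation_nonempty.
- exact: approximation_almost_free.
- exact: approximation_almost_free.
- exact: (restriction_controlled metX metY frE genS bf).
- exact: (restriction_controlled metY metX grE genT bg).
- exact: (restriction_almost_inverse metX frE grE gf).
- exact: (restriction_almost_inverse metY grE frE fg).
- exact: (restriction_finite_to_one metX frE gf).
- exact: (restriction_finite_to_one metY grE fg).
Qed.

(** * The coupling carried by the generic points *)

Lemma countable_generated (G : groupType) (S : seq G) : generates S -> countable [set: G].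
Proof.
move=> genS; apply/countable_injP.
pose E := S ++ [seq s^-1%g | s <- S].
have [w Hw] := choice genS.
exists (fun g => choice.pickle [seq index x E | x <- w g]) => g h _ _.
move=> /(pcan_inj choice.pickleK) e.
have wE k : [seq nth 1%g E i | i <- [seq index x E | x <- w k]] = w k.
  rewrite -map_comp -[RHS]map_id; apply/eq_in_map => x xw /=.
  have [/allP/(_ x xw) xS _] := Hw k; rewrite nth_index// mem_cat.
  case/orP: xS => [->//|xS]; apply/orP; right.
  by rewrite -[x]invgK map_f.
by have [_ <-] := Hw g; have [_ <-] := Hw h; rewrite -wE e wE.
Qed.

Section generic_points.
Context {G L : groupType}.
Notation index := (G * L * bool)%type.
Context {Bf : G -> seq L} {Bg : L -> seq G} {B1 : seq G} {B2 : seq L}.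
Notation generic := (generic Bf Bg B1 B2).
Implicit Type w : cube index.

(** The domains of both functions are nonempty and invariant under translation. *)
Lemma generic_total w a : generic w -> exists b, w (a, b, false).
Proof.
move=> gw; have [a0 [b0 w0]] : exists a0 b0, w (a0, b0, false).
  have [[[a0 b0] []] w0] := gen_nonzero gw; last by exists a0, b0.
  by have [c _ wc] := gen_inv' gw w0; exists a0, (c * b0)%g.
have [c _] := gen_step gw (a * a0^-1)%g w0.
by rewrite mulgVK => wc; exists (c * b0)%g.
Qed.

Lemma generic_total' w b : generic w -> exists a, w (a, b, true).
Proof.
move=> gw; have [b0 w0] := generic_total 1%g gw.
have [c _ wc] := gen_inv gw w0.
have [c' _] := gen_step' gw (b * b0^-1)%g wc.
by rewrite mulgVK => wc'; exists (c' * (c * 1))%g.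
Qed.

Lemma generic_quasi_isometric (R : realType) (S : seq G) (T : seq L) w :
  generates S -> generates T -> generic w ->
  quasi_isometric (word_metric R S) (word_metric R T).
Proof.
move=> genS genT gw.
have [phi Hphi] := choice (fun a => generic_total a gw).
have [psi Hpsi] := choice (fun b => generic_total' b gw).
have phiE a b : w (a, b, false) -> phi a = b by move=> wab; exact: (gen_fun gw) (Hphi a) wab.
have psiE a b : w (a, b, true) -> psi b = a by move=> wab; exact: (gen_fun' gw) (Hpsi b) wab.
apply: (quasi_isometric_of_controlled R genS genT (phi := phi) (psi := psi)).
- move=> h; exists (Bf h) => a; have [c cB /phiE ->] := gen_step gw h (Hphi a).
  by rewrite mulgK.
- move=> k; exists (Bg k) => b; have [c cB /psiE ->] := gen_step' gw k (Hpsi b).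
  by rewrite mulgK.
- exists B1 => a; have [c cB /psiE ->] := gen_inv gw (Hphi a).
  by rewrite mulgK.
- exists B2 => b; have [c cB /phiE ->] := gen_inv' gw (Hpsi b).
  by rewrite mulgK.
Qed.

Lemma shift_left_action : left_action (@shift_left G L).
Proof.
split=> [w|g h w]; apply/funext => -[[a b] c]; rewrite /shift_left/= ?mulg1//.
by rewrite mulgA.
Qed.

Lemma shift_right_action : right_action (@shift_right G L).
Proof.
split=> [w|h k w]; apply/funext => -[[a b] c]; rewrite /shift_right/= ?invg1 ?mulg1//.
by rewrite invMg mulgA.
Qed.

Lemma in_shift_left g a b c w :
  (shift_left g @` containing [:: (a, b, c)]) w <-> w (a * g^-1, b, c)%g.
Proof.
split=> [[v + <-]|wg]; first by rewrite /containing/shift_left/= andbT mulgVK.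
exists (shift_left g^-1%g w); first by rewrite /containing/shift_left/= andbT.
by rewrite -(shift_left_action.2) mulgV (shift_left_action.1).
Qed.

Lemma in_shift_right k a b c w :
  ((fun v => shift_right v k) @` containing [:: (a, b, c)]) w <-> w (a, b * k, c)%g.
Proof.
split=> [[v + <-]|wg]; first by rewrite /containing/shift_right/= andbT mulgK.
exists (shift_right w k^-1%g); first by rewrite /containing/shift_right/= andbT invgK.
by rewrite -(shift_right_action.2) mulVg (shift_right_action.1).
Qed.

Lemma generic_left_free g w : generic w -> shift_left g w = w -> g = 1%g.
Proof.
move=> gw e; have [a wa] := generic_total' 1%g gw.
have : w (a * g, 1, true)%g.
  by have := congr1 (fun v : cube index => v (a, 1%g, true)) e; rewrite /shift_left/= => ->.
by move=> /(gen_fun' gw wa) ag; apply: (mulgI a); rewrite mulg1 -ag.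
Qed.

Lemma generic_right_free k w : generic w -> shift_right w k = w -> k = 1%g.
Proof.
move=> gw e; have [b wb] := generic_total 1%g gw.
have : w (1, b * k^-1, false)%g.
  by have := congr1 (fun v : cube index => v (1%g, b, false)) e; rewrite /shift_right/= => ->.
move=> /(gen_fun gw wb) bk; apply: invg_inj; rewrite invg1.
by apply: (mulgI b); rewrite mulg1 -bk.
Qed.

Section coupling.
Context (R : realType) (rho : {measure set (borel_type (cube index)) -> \bar R}).
Hypotheses (rho1 : rho (containing [:: (1, 1, false)]%g) = 1%E)
  (rhofin : forall p, (rho (containing [:: p]) < +oo)%E)
  (rhogen : rho.-negligible (~` generic))
  (rhol : forall h, measure_preserving rho (shift_left h))
  (rhor : forall k, measure_preserving rho (fun w => shift_right w k)).

Lemma exists_generic : exists w, generic w.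
Proof.
apply: contrapT => ngen.
pose A : set (borel_type (cube index)) := containing [:: (1, 1, false)]%g.
have mA : measurable A.
  by apply: bounded_clopen_measurable; exact: bounded_clopen_containing.
have nA : rho.-negligible A.
  by apply: negligibleS rhogen => w _ gw; apply: ngen; exists w.
have : rho A = 0%E by exact: measure_negligible.
by rewrite rho1 => /eqP; rewrite onee_eq0.
Qed.

(** Almost every point lies in the translate of {a (1, 1)} by t exactly when a (1, t),
    and in the translate of {b (1, 1)} by s exactly when b (s^-1, 1); every clause is then
    a property of generic points. *)
Lemma uniform_measure_coupling :
  measure_coupling rho shift_left shift_right
    (containing [:: (1, 1, true)]%g) (containing [:: (1, 1, false)]%g) /\
  uniform_coupling rho shift_left shift_right
    (containing [:: (1, 1, true)]%g) (containing [:: (1, 1, false)]%g).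
Proof.
have mC p : measurable (containing [:: p] : set (borel_type (cube index))).
  by apply: bounded_clopen_measurable; exact: bounded_clopen_containing.
have ngen (A : set (borel_type (cube index))) :
    (forall w, A w -> ~ generic w) -> rho.-negligible A.
  by move=> AN; apply: negligibleS rhogen.
split; split.
- move=> r0; have := rho1; rewrite (subset_measure0 _ _ (@subsetT _ _) r0)//.
  by move=> /eqP; rewrite eq_sym onee_eq0.
- exact: shift_left_action.
- exact: shift_right_action.
- by [].
- exact: rhol.
- exact: rhor.
- by apply: ngen => w /= nf gw; apply: nf => g; exact: generic_left_free.
- by apply: ngen => w /= nf gw; apply: nf => k; exact: generic_right_free.
- split=> //.
  + move=> g h gh; apply: ngen => w [/in_shift_left wg /in_shift_left wh] gw.
    by apply: gh; apply: invg_inj; rewrite -[LHS]mul1g -[RHS]mul1g; exact: (gen_fun' gw) wg wh.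
  + apply: ngen => w nw gw; apply: nw; have [a wa] := generic_total' 1%g gw.
    by exists a^-1%g => //; apply/in_shift_left; rewrite invgK mul1g.
- split=> //.
  + move=> g h gh; apply: ngen => w [/in_shift_right wg /in_shift_right wh] gw.
    by apply: gh; rewrite -[LHS]mul1g -[RHS]mul1g; exact: (gen_fun gw) wg wh.
  + apply: ngen => w nw gw; apply: nw; have [b wb] := generic_total 1%g gw.
    by exists b => //; apply/in_shift_right; rewrite mul1g.
- exact: rhofin.
- exact: rhofin.
- move=> g; exists (Bf g); apply: ngen => w [/in_shift_left wg nw] gw; apply: nw.
  have [c cB] := gen_step gw g wg; rewrite mul1g mulgV mulg1 => wc.
  by exists c => //; apply/in_shift_right; rewrite mul1g.
- move=> h; exists [seq x^-1%g | x <- Bg h^-1%g].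
  apply: ngen => w [/in_shift_right wh nw] gw; apply: nw.
  have [c cB] := gen_step' gw h^-1%g wh; rewrite mul1g mulVg mulg1 => wc.
  exists c^-1%g; first by rewrite /= map_f.
  by apply/in_shift_left; rewrite invgK mul1g.
Qed.

End coupling.
End generic_points.

(** * Quasi-isometry and uniform measure equivalence *)

Theorem theorem1p2 (R : realType) (Gamma Lambda : groupType)
    (S : seq Gamma) (T : seq Lambda)
    (genS : generates S) (genT : generates T)
    (soficGamma : sofic R Gamma) (soficLambda : sofic R Lambda)
    (X : sofic_approximation R S) (Y : sofic_approximation R T)
    (dX : space_of_graphs X -> space_of_graphs X -> R)
    (dY : space_of_graphs Y -> space_of_graphs Y -> R)
    (metX : graphs_metric dX) (metY : graphs_metric dY) :
  coarsely_equivalent dX dY ->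
  quasi_isometric (word_metric R S) (word_metric R T)
  /\ uniformly_measure_equivalent R Gamma Lambda.
Proof.
move=> ce.
have [r [s [fr [gr fc]]]] :=
  finite_coupling_of_coarse_equivalence genS genT metX metY ce.
have [rho [Bf [Bg [B1 [B2 [rho1 rhofin rhogen rhol rhor]]]]]] :=
  limit_measure fc (countable_generated genS) (countable_generated genT).
split.
  have [w gw] := exists_generic rho1 rhogen.
  exact: generic_quasi_isometric genS genT gw.
exists (cube (Gamma * Lambda * bool)%type), rho, shift_left, shift_right,
  (containing [:: (1, 1, true)]%g), (containing [:: (1, 1, false)]%g).
exact: (uniform_measure_coupling rho1 rhofin rhogen rhol rhor).
Qed.
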